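(* Let $n\ge0$ and let $\sigma,\tau\in\mathrm{Typ}(n)$ be types of $n$. (1) The coefficient of $P_\tau$ in the expansion of $H_\sigma$ in the basis $\{P_\rho:\rho\in\mathrm{Typ}(n)\}$ is $|\mathcal{PT}^{\mathrm{osimp}}(\sigma,\tau)|/z^\otimes_\tau$. (2) The coefficient of $P_\tau$ in the expansion of $E_\sigma$ in the basis $\{P_\rho:\rho\in\mathrm{Typ}(n)\}$ is $(-1)^{\ell(\tau)}|\mathcal{PT}^{\mathrm{osimp}}(\sigma,\tau)|/z^\otimes_\tau$.
   Context: A type of $n$ is a sequence $\tau=(\tau|^1,\tau|^2,\dots)$ of (possibly empty) integer partitions with $\sum_{i\ge1} i\,|\tau|^i|=n$, where $|\tau|^i|$ is the size of the partition $\tau|^i$; $\mathrm{Typ}(n)$ is the set of types of $n$. Its length is $\ell(\tau)=\sum_i\ell(\tau|^i)$. Each part $d$ of $\tau|^r$ gives a block $d^r$ of $\tau$ (degree $d$, multiplicity $r$; not exponentiation). We list the blocks as $\tau=d_1^{r_1}d_2^{r_2}\cdots d_s^{r_s}$ with $r_1\le\cdots\le r_s$, blocks of equal multiplicity $r$ being listed in the (weakly decreasing) order of the parts of $\tau|^r$. For a partition $\lambda$, $z_\lambda=\prod_{i\ge1} i^{m_i(\lambda)}m_i(\lambda)!$, where $m_i(\lambda)$ is the number of parts of $\lambda$ equal to $i$. For a type $\tau$, $z_\tau^\otimes=\prod_{i\ge1} z_{\tau|^i}$. Let $x_{i,j}$ ($i,j\ge 1$) be indeterminates with $\deg x_{i,j}=i$;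 all series have rational coefficients. A monomial is square-free if every exponent is at most $1$. $H_d$ is the sum of all monomials of degree $d$; $E_d$ is the sum over square-free monomials $f$ of degree $d$ of $(-1)^{m(f)}f$, where $m(f)$ is the number of indeterminates in $f$; for $d\ge1$, $P_d=\sum_{k\mid d}\sum_{j\ge1}k\,x_{k,j}^{d/k}$. For $F\in\{H,E,P\}$, $F_{d^r}$ is obtained from $F_d$ by replacing each $x_{i,j}$ by $x_{i,j}^r$, and $F_\tau=\prod F_{d^r}$ over all blocks $d^r$ of $\tau$ (counted with repetition; empty product $=1$). It is known that $\{F_\tau\}_{\tau\in\mathrm{Typ}(n)}$ is, for each such $F$, a $\mathbb{Q}$-basis of the space $\mathrm{PSym}(n)$ of polysymmetric functions of degree $n$ (power series homogeneous of degree $n$ that are symmetric separately in each variable set $\{x_{i,j}\}_{j\ge1}$). The diagram of a partition $\lambda$ has left-justified rows of $\lambda_1,\lambda_2,\dots$ cells; the tensor diagram of $\sigma$ is the sequence of diagrams of $\sigma|^1,\sigma|^2,\dots$, the $i$th one being called the $i$th tensor factor. A brick is a nonempty set of consecutive cells in one row; its length is its number of cells. An ordered simple polybrick tabloid of shape $\sigma$ and content $\tau=d_1^{r_1}\cdots d_s^{r_s}$ is a decomposition of the tensor diagram of $\sigma$ into $s$ disjoint bricks labeled bijectively by $1,\dots,s$ such that, for each $1\le l\le s$, the brick labeled $l$ has length $d_l$ and lies in the $r_l$th tensor factor, and the labels increase from left to right in each row of each tensor factor. $\mathcal{PT}^{\mathrm{osimp}}(\sigma,\tau)$ is the set of these.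 *)

(* Defs.v *)
(* MathComp: the monomials are those of multinomials' monalg, and the sums
   \sum_(x \in A) are those of mathcomp-classical's fsbigop (equal to 0 if
   infinitely many terms are nonzero, which never matters below). *)
From HB Require Import structures.
From mathcomp Require Import all_boot all_order all_algebra finmap.
From mathcomp Require Import boolp classical_sets functions cardinality fsbigop.
From mathcomp.multinomials Require Import monalg.

Set Implicit Arguments.
Unset Strict Implicit.
Unset Printing Implicit Defensive.

Import Order.TTheory GRing.Theory Num.Theory.
Local Open Scope nat_scope.

Definition posint : choiceType := {i : nat | 0 < i}.

(** ** Partitions and types *)

Definition is_partition (l : seq nat) : bool := sorted geq l && (0 \notin l).

Definition intpart : choiceType := {l : seq nat | is_partition l}.

Definition part0 : intpart := exist _ [::] (erefl true).

(* Sequences (tau|^1, tau|^2, ...) of partitions, almost all of them empty;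
   [tau i] is tau|^i. *)
Definition parttype : choiceType := {fsfun posint -> intpart with part0}.

Definition type_size (tau : parttype) : nat :=
  \sum_(i <- finsupp tau) val i * sumn (val (tau i)).

Definition Typ (n : nat) : choiceType := {tau : parttype | type_size tau == n}.

Definition type_length (tau : parttype) : nat :=
  \sum_(i <- finsupp tau) size (val (tau i)).

(* The pair (d, r) is the block d^r; the list is ordered by increasing
   multiplicity r, then by decreasing degree d. *)
Definition blocks (tau : parttype) : seq (nat * posint) :=
  flatten [seq [seq (d, r) | d <- val (tau r)]
          | r <- sort (fun i j : posint => val i <= val j) (finsupp tau)].

Definition z_part (l : seq nat) : nat :=
  \prod_(i <- undup l) (i ^ count_mem i l * (count_mem i l)`!).

Definition z_type (tau : parttype) : nat :=
  \prod_(i <- finsupp tau) z_part (val (tau i)).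

(** ** Formal power series in the indeterminates x_(i,j), i, j >= 1 *)

Definition indet : choiceType := (posint * posint)%type.

Definition mon : choiceType := cmonom indet.

(* [f m] is the coefficient of the monomial m in the series f; the pointwise
   product of functions is not the product of series. *)
Definition series := mon -> rat.

(* deg x_(i,j) = i *)
Definition mon_deg (m : mon) : nat := \sum_(v <- finsupp m) val v.1 * m v.

Definition mon_nvars (m : mon) : nat := #|` finsupp m|.

Definition squarefree (m : mon) : bool := all (fun v => m v <= 1) (finsupp m).

Section Series.
Local Open Scope classical_set_scope.
Local Open Scope ring_scope.

Definition series1 : series := fun m => (m == onecm indet)%:R.

(* The index set is finite for every m. *)
Definition series_mul (f g : series) : series := fun m =>
  \sum_(p \in [set p : mon * mon | mulcm p.1 p.2 = m]) f p.1 * g p.2.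

(* Substitution of x_(i,j)^r for every x_(i,j): the monomial m' becomes its
   r-th power. *)
Definition series_subst (r : nat) (f : series) : series := fun m =>
  \sum_(m' \in [set m' : mon | expcmn m' r = m]) f m'.

Definition serH (d : nat) : series := fun m => (mon_deg m == d)%:R.

Definition serE (d : nat) : series := fun m =>
  if squarefree m && (mon_deg m == d) then (-1) ^+ mon_nvars m else 0.

(* Only meaningful for d >= 1, in which case for every m only finitely many
   (k, j) contribute. *)
Definition serP (d : nat) : series := fun m =>
  \sum_(k \in [set k : posint | (val k %| d)%N])
    \sum_(j \in [set: posint])
      ((val k)%:R * (m == expcmn (ucm (k, j)) (d %/ val k))%:R : rat).

Definition ser_type (F : nat -> series) (tau : parttype) : series :=
  \big[series_mul/series1]_(b <- blocks tau) series_subst (val b.2) (F b.1).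

Definition expandsP (n : nat) (f : series) (c : Typ n -> rat) : Prop :=
  forall m : mon,
    f m = \sum_(rho \in [set: Typ n]) c rho * ser_type serP (val rho) m.

(* The series f is, in a unique way, a linear combination of the P_rho, rho a
   type of n, and a is the coefficient of P_tau in it. *)
Definition coefP (n : nat) (f : series) (tau : Typ n) (a : rat) : Prop :=
  exists c : Typ n -> rat,
    [/\ expandsP f c,
        forall c' : Typ n -> rat, expandsP f c' -> c' =1 c
      & c tau = a].

End Series.

(** ** Ordered simple polybrick tabloids *)

(* (r, (i, j)) is the cell in row i and column j (both counted from 0) of the
   r-th tensor factor. *)
Definition cells (sigma : parttype) : seq (posint * (nat * nat)) :=
  [seq (r, ij) | r <- finsupp sigma,
                 ij <- [seq (i, j) | i <- iota 0 (size (val (sigma r))),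
                                     j <- iota 0 (nth 0 (val (sigma r)) i)]].

Definition cell (sigma : parttype) := seq_sub (cells sigma).

Section Tabloids.
Variable sigma : parttype.
Implicit Types (c : cell sigma) (B : {set cell sigma}).

Definition cell_factor c : posint := (val c).1.
Definition cell_row c : nat := (val c).2.1.
Definition cell_col c : nat := (val c).2.2.

Definition same_row c c' : bool :=
  (cell_factor c == cell_factor c') && (cell_row c == cell_row c').

Definition is_brick B : bool :=
  [&& B != finset.set0,
      [forall c in B, forall c' in B, same_row c c']
    & [forall c in B, forall c' in B, forall e,
        same_row c e && (cell_col c <= cell_col e <= cell_col c') ==>
          (e \in B)]].

(* [T l] is the brick with label l + 1, and [tnth (in_tuple (blocks tau)) l] is
   the block d_(l+1)^(r_(l+1)). *)
Definition is_osimp (tau : parttype)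
    (T : {ffun 'I_(size (blocks tau)) -> {set cell sigma}}) : bool :=
  [&& [forall l, is_brick (T l)],
      [forall l, forall l', (l != l') ==> [disjoint T l & T l']],
      [forall c, exists l, c \in T l],
      [forall l, #|T l| == (tnth (in_tuple (blocks tau)) l).1],
      [forall l, forall c in T l,
        cell_factor c == (tnth (in_tuple (blocks tau)) l).2]
    & [forall l : 'I_(size (blocks tau)), forall l' : 'I_(size (blocks tau)),
        (l < l') ==>
          [forall c in T l, forall c' in T l',
            same_row c c' ==> (cell_col c < cell_col c')]]].

Definition PTosimp (tau : parttype) :
    {set {ffun 'I_(size (blocks tau)) -> {set cell sigma}}} :=
  [set T | is_osimp T].

End Tabloids.

(* Main.v *)
(* A type is encoded as the monomial mu in indeterminates p_b, b = (d, r), whose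
   exponent at b is the number of blocks d^r; P_mu (below, cmeval blockser mu) is
   its value at p_b = P_{d^r}.

   Both H_d and E_d are the degree-d parts of a product over all indeterminates
   of a series sum_a g(a) x^a with a g(a) = eps (g(a-1) + ... + g(0)), where
   eps = 1 for H and eps = -1 for E.  Hence d F_d = eps (P_1 F_{d-1} + ... + P_d F_0),
   and the product of F_{e_i^{r_i}} over the rows i of sigma satisfies a
   Newton-type recursion in e.  Let N(e, mu) be the number of ways to distribute
   the blocks of mu over the rows so that row i receives total degree e_i:
   placing one distinguished block first shows that eps^l(mu) N(e, mu) / z_mu obeys
   the same recursion, so these are the coefficients.  A tabloid is determined by
   the rows of its bricks, as the labels dictate their order within each row, so
   N(e, tau) counts tabloids.

   The P_mu are independent by triangularity: if a monomial m occurs in P_mu,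
   the indeterminates of m have total degree at most the sum of the degrees of
   the blocks of mu, with equality only if mu can be read off m (each block d^r
   contributing its own x_{d,j}^r). *)
Require Import Defs.
From HB Require Import structures.
From mathcomp Require Import all_boot all_order all_algebra finmap.
From mathcomp Require Import boolp classical_sets functions cardinality fsbigop.
From mathcomp.multinomials Require Import monalg.
From mathcomp Require Import zify ring.

Set Implicit Arguments.
Unset Strict Implicit.
Unset Printing Implicit Defensive.

Import Order.TTheory GRing.Theory Num.Theory.
Local Open Scope nat_scope.

(** * Monomials *)

Lemma posint_gt0 (k : posint) : 0 < val k.
Proof. exact: (valP k). Qed.

HB.instance Definition _ (J : choiceType) :=
  Monoid.isComLaw.Build {cmonom J} (onecm J) (@mulcm J) (@mulcmA J) (@mulcmC J) (@mul0cm J).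

Section Cmonom.
Variable J : choiceType.
Implicit Types (m d : {cmonom J}) (v w : J).

Lemma cm_ext m1 m2 : (forall i, m1 i = m2 i) -> m1 = m2.
Proof. by move=> h; apply/eqP/cmP. Qed.

Lemma expcmnS m n : expcmn m n.+1 = mulcm m (expcmn m n).
Proof. by case: n => [|n]; rewrite /expcmn ?iteropS//= mulcm0. Qed.

Lemma expcmnE m n i : expcmn m n i = m i * n.
Proof.
elim: n => [|n IHn]; first by rewrite muln0 onecmE.
by rewrite expcmnS mulcmE IHn mulnS.
Qed.

Lemma ucmXE v n i : expcmn (ucm v) n i = (v == i) * n.
Proof. by rewrite expcmnE ucmE. Qed.

Lemma expcmn_inj r : 0 < r -> injective (fun m => expcmn m r).
Proof.
move=> r0 m1 m2 h; apply: cm_ext => i.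
have /(congr1 (fun m : {cmonom J} => m i)) := h; rewrite !expcmnE => /eqP.
by rewrite eqn_pmul2r// => /eqP.
Qed.

Definition dvdcm d m := forall i, d i <= m i.

Lemma dvdcm_mulr d m : dvdcm d (mulcm d m).
Proof. by move=> i; rewrite mulcmE leq_addr. Qed.

Lemma dvdcm_mull d m : dvdcm d (mulcm m d).
Proof. by move=> i; rewrite mulcmE leq_addl. Qed.

Lemma dvdcm_trans d1 d2 d3 : dvdcm d1 d2 -> dvdcm d2 d3 -> dvdcm d1 d3.
Proof. by move=> h k i; apply: leq_trans (h i) (k i). Qed.

Lemma mulcm_div d m : dvdcm d m -> mulcm d (divcm m d) = m.
Proof. by move=> h; apply: cm_ext => i; rewrite mulcmE divcmE subnKC. Qed.

Lemma mulcmK d m : divcm (mulcm d m) d = m.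
Proof. by apply: cm_ext => i; rewrite divcmE mulcmE addKn. Qed.

Lemma dvdcm_ucm v n m : dvdcm (expcmn (ucm v) n) m <-> n <= m v.
Proof.
split=> [/(_ v)|h i]; rewrite ucmXE ?eqxx ?mul1n//.
by case: eqP => [<-|]; rewrite ?mul1n.
Qed.

(** Induction on [s], splitting off the power of [v]. The finiteness of the set of divisors of a
    monomial and of the set of types of a given size both come from here. *)
Lemma bounded_cmonoms (s : seq J) (N : nat) :
  exists X : seq {cmonom J}, forall d,
    {subset finsupp d <= s} -> (forall i, d i <= N) -> d \in X.
Proof.
elim: s => [|v s [X hX]].
  exists [:: onecm J] => d hd _; rewrite inE; apply/cmP => i; rewrite onecmE.
  by apply/eqP; rewrite cmE_eq0; apply/negP => /hd.
exists [seq mulcm (expcmn (ucm v) e) d | e <- iota 0 N.+1, d <- X] => d hd hN.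
have dv : dvdcm (expcmn (ucm v) (d v)) d by apply/dvdcm_ucm.
rewrite -(mulcm_div dv); apply: allpairs_f.
  by rewrite mem_iota /= add0n ltnS.
apply: hX => [i|i]; last by rewrite divcmE (leq_trans (leq_subr _ _)).
rewrite -cmE_neq0 divcmE ucmXE.
case: (eqVneq v i) => [<-|vi]; first by rewrite mul1n subnn.
rewrite subn0 cmE_neq0 => /hd; rewrite inE => /orP[/eqP iv|//].
by rewrite iv eqxx in vi.
Qed.

Lemma divisors_cmonom m :
  exists X : seq {cmonom J}, forall d, dvdcm d m -> d \in X.
Proof.
have [X hX] := bounded_cmonoms (finsupp m) (mdeg m).
exists X => d dm; apply: hX => i.
  by rewrite -!cmE_neq0 -!lt0n => /leq_trans; apply.
apply: leq_trans (dm i) _; rewrite mdegE.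
have [im|] := boolP (i \in finsupp m); last by rewrite -cmE_eq0 => /eqP ->.
by rewrite (big_fsetD1 i)//= leq_addr.
Qed.

(** Exponent 0 contributes the neutral element, so the supports of several monomials can be replaced
    by one common finite set. *)
Lemma big_cmonom_sub (R : Type) (idx : R) (op : Monoid.com_law idx)
    (F : J -> nat -> R) m (X : {fset J}) :
  (forall i, F i 0 = idx) -> {subset finsupp m <= X} ->
  \big[op/idx]_(i <- finsupp m) F i (m i) = \big[op/idx]_(i <- X) F i (m i).
Proof.
move=> F0 mX; apply: big_fset_incl; first exact/fsubsetP.
by move=> i _ /=; rewrite -cmE_eq0 => /eqP ->.
Qed.

(** Common source of the additivity of [mon_deg], [mon_wt] and [block_deg] and of the
    multiplicativity of [cmeval]. *)
Lemma big_cmonomM (R : Type) (idx : R) (op : Monoid.com_law idx)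
    (F : J -> nat -> R) m1 m2 :
  (forall i, F i 0 = idx) ->
  (forall i n1 n2, F i (n1 + n2) = op (F i n1) (F i n2)) ->
  \big[op/idx]_(i <- finsupp (mulcm m1 m2)) F i (mulcm m1 m2 i) =
  op (\big[op/idx]_(i <- finsupp m1) F i (m1 i))
     (\big[op/idx]_(i <- finsupp m2) F i (m2 i)).
Proof.
move=> F0 FD; pose X := (finsupp m1 `|` finsupp m2)%fset.
rewrite (@big_cmonom_sub _ _ op F m1 X)//; last by move=> i; rewrite inE => ->.
rewrite (@big_cmonom_sub _ _ op F m2 X)//; last by move=> i; rewrite inE orbC => ->.
rewrite (@big_cmonom_sub _ _ op F _ X)//; last by move=> i; rewrite mdomD.
by rewrite -big_split; apply: eq_bigr => i _; rewrite mulcmE FD.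
Qed.

Lemma big_cmonomU (R : Type) (idx : R) (op : Monoid.com_law idx)
    (F : J -> nat -> R) v :
  \big[op/idx]_(i <- finsupp (ucm v)) F i (ucm v i) = F v 1.
Proof. by rewrite mdomU big_seq_fset1 ucmE eqxx. Qed.

Lemma big_cmonom1 (R : Type) (idx : R) (op : Monoid.com_law idx)
    (F : J -> nat -> R) :
  \big[op/idx]_(i <- finsupp (onecm J)) F i (onecm J i) = idx.
Proof. by rewrite [onecm J]/(mone) mdom1 big_seq_fset0. Qed.

Lemma big_mulcmE (K : Type) (r : seq K) (P : pred K) (F : K -> {cmonom J}) i :
  (\big[@mulcm J/onecm J]_(k <- r | P k) F k) i = \sum_(k <- r | P k) F k i.
Proof.
exact: (big_morph (fun m : {cmonom J} => m i) (fun m1 m2 => mulcmE m1 m2 i) (onecmE i)).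
Qed.

Lemma cmonom_ind (P : {cmonom J} -> Prop) :
  P (onecm J) -> (forall v m, P m -> P (mulcm (ucm v) m)) -> forall m, P m.
Proof.
move=> P1 PM m; move: {2}(mdeg m) (erefl (mdeg m)) => n.
elim: n m => [|n IHn] m; first by move=> /mdeg_eq0I ->.
move=> hm; have [i im] : exists i, i \in finsupp m.
  have [/eqP|//] := fset_0Vmem (finsupp m).
    by move=> h; move: hm; rewrite mdegE (eqP h) big_seq_fset0.
  by case=> i; exists i.
have dv : dvdcm (ucm i) m.
  by apply/(dvdcm_ucm i 1); rewrite lt0n cmE_neq0.
rewrite -(mulcm_div dv); apply/PM/IHn; apply/eqP.
by rewrite -(eqn_add2l 1) -{1}(mdegU i) -mdegM -[mmul _ _]/(mulcm _ _) mulcm_div// hm.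
Qed.

End Cmonom.

(** * Evaluation of monomials *)

Section MonomialEvaluation.
Variables (J : choiceType) (R : comNzRingType) (f : J -> R).
Implicit Types m : {cmonom J}.
Local Open Scope ring_scope.

(** Evaluated at [blockser] this is P_mu; at [placement] it is the generating polynomial of the
    distributions of blocks over rows. *)
Definition cmeval m : R := \prod_(i <- finsupp m) f i ^+ m i.

Lemma cmevalM m1 m2 : cmeval (mulcm m1 m2) = cmeval m1 * cmeval m2.
Proof.
apply: (@big_cmonomM J R 1 *%R (fun i n => f i ^+ n)) => [i|i n1 n2].
  by rewrite expr0.
by rewrite exprD.
Qed.

Lemma cmevalU v : cmeval (ucm v) = f v.
Proof. exact: (big_cmonomU *%R (fun i n => f i ^+ n)). Qed.

Lemma cmeval1 : cmeval (onecm J) = 1.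
Proof. exact: (big_cmonom1 *%R (fun i n => f i ^+ n)). Qed.

Lemma cmeval_prod (s : seq J) :
  cmeval (\big[@mulcm J/onecm J]_(b <- s) ucm b) = \prod_(b <- s) f b.
Proof.
by rewrite (big_morph _ cmevalM cmeval1); apply: eq_bigr => i _; rewrite cmevalU.
Qed.
End MonomialEvaluation.

(** * The ring of formal power series *)

Section MalgMonomial.
Variables (J : choiceType) (R : nzRingType).
Local Open Scope ring_scope.

Lemma mcoeff_sum (K : choiceType) (G : zmodType) (I : Type) (r : seq I) (P : pred I)
    (F : I -> {malg G[K]}) k :
  (\sum_(i <- r | P i) F i)@_k = \sum_(i <- r | P i) (F i)@_k.
Proof. exact: raddf_sum. Qed.

Lemma mcoeff_cmonomM c (u : {cmonom J}) (G : {malg R[{cmonom J}]}) m :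
  dvdcm u m -> (<<c *g u>> * G)@_m = c * G@_(divcm m u).
Proof.
move=> um; rewrite (mcoeffMlw _ msuppU_le (fsubset_refl _)) big_seq_fset1 mcoeffUU.
rewrite [in RHS](congr1 (mcoeff _) (monalgE G)) mcoeff_sum mulr_sumr.
apply: eq_bigr => k _; rewrite mcoeffU -mulrnAr; congr (_ * (_ *+ nat_of_bool _)).
by apply/eqP/eqP => [<-|->]; [rewrite mulcmK|apply: mulcm_div].
Qed.

Lemma mcoeff_cmonomM_ndvd c (u : {cmonom J}) (G : {malg R[{cmonom J}]}) m :
  ~ dvdcm u m -> (<<c *g u>> * G)@_m = 0.
Proof.
move=> ndv; rewrite (mcoeffMlw _ msuppU_le (fsubset_refl _)) big_seq_fset1.
apply: big1 => k _; case: eqP => // h; case: ndv; rewrite -h.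
exact: dvdcm_mulr.
Qed.
End MalgMonomial.

(** * Ring laws for series, by truncation to polynomials *)

Section SeriesRing.
Local Open Scope classical_set_scope.
Local Open Scope ring_scope.
Implicit Types (f g : series) (F G : {malg rat[{cmonom indet}]}) (m d : {cmonom indet}).

HB.instance Definition _ := GRing.Zmodule.copy series (mon -> rat).

Lemma seriesDE f g m : (f + g) m = f m + g m. Proof. by []. Qed.

Lemma series_ext f g : (forall m, f m = g m) -> f = g.
Proof. by move=> h; apply/funext. Qed.

Lemma series_sumE (I : Type) (r : seq I) (P : pred I) (F : I -> series) m :
  (\sum_(i <- r | P i) F i) m = \sum_(i <- r | P i) F i m.
Proof. by elim/big_rec2: _ => // i x y _ <-. Qed.

Lemma series_mulnE f n m : (f *+ n) m = f m *+ n.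
Proof. by elim: n => // n IHn; rewrite !mulrSr seriesDE IHn. Qed.

(** The coefficient of a product at [m] involves only divisors of [m]. Hence series can be replaced
    by polynomials that agree with them on these divisors, and the ring laws are inherited from
    polynomials. *)
Definition malg_agrees m f F := forall d, dvdcm d m -> f d = F@_d.

Lemma malg_approx m f : exists F, malg_agrees m f F.
Proof.
have [X hX] := divisors_cmonom m.
exists (\sum_(k <- undup X) << f k *g k >>) => d.
move=> /hX dX.
rewrite mcoeff_sum; under eq_bigr do rewrite mcoeffU.
rewrite (bigD1_seq d) ?mem_undup ?undup_uniq//= eqxx big1 ?addr0//.
by move=> k /negPf ->.
Qed.

Lemma series_mul_agrees m f g F G :
  malg_agrees m f F -> malg_agrees m g G -> malg_agrees m (series_mul f g) (F * G).
Proof.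
move=> fF gG d dm; rewrite /series_mul.
set r := [seq (a, b) | a <- msupp F, b <- msupp G].
have ur : uniq r by apply: allpairs_uniq => // -[? ?] [? ?].
transitivity (\sum_(p \in [set` [pred p : mon * mon | mulcm p.1 p.2 == d]])
   F@_p.1 * G@_p.2).
  rewrite (_ : [set p | _] = [set` [pred p : mon * mon | mulcm p.1 p.2 == d]]); last first.
    by apply/seteqP; split=> p /=; rewrite inE => /eqP.
  apply: eq_fsbigr => p; rewrite !inE => /eqP pd.
  congr (_ * _); [apply: fF|apply: gG]; apply: dvdcm_trans dm; rewrite -pd.
    exact: dvdcm_mulr.
  exact: dvdcm_mull.
rewrite -(@bigfs _ _ _ _ r)//; last first.
  case=> a b /= _ abr.
  have [aF|/mcoeff_outdom ->] := boolP (a \in msupp F); last by rewrite mul0r.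
  have [bG|/mcoeff_outdom ->] := boolP (b \in msupp G); last by rewrite mulr0.
  by rewrite allpairs_f in abr.
rewrite big_mkcond /r big_allpairs_dep mcoeffMl; apply: eq_bigr => a _.
by apply: eq_bigr => b _; rewrite inE /= mulrb.
Qed.

Lemma series_mul_malg m f g F G :
  malg_agrees m f F -> malg_agrees m g G -> series_mul f g m = (F * G)@_m.
Proof. by move=> fF gG; apply: (series_mul_agrees fF gG) => i. Qed.

Lemma series1_agrees m : malg_agrees m series1 1.
Proof. by move=> d _; rewrite mcoeff1. Qed.

Lemma series_addr_agrees m f g F G :
  malg_agrees m f F -> malg_agrees m g G -> malg_agrees m (f + g) (F + G).
Proof. by move=> fF gG d dm; rewrite mcoeffD -fF -?gG. Qed.

Lemma series_mulA : associative series_mul.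
Proof.
move=> f g h; apply: series_ext => m.
have [F fF] := malg_approx m f; have [G gG] := malg_approx m g.
have [H hH] := malg_approx m h.
rewrite (series_mul_malg fF (series_mul_agrees gG hH)).
by rewrite (series_mul_malg (series_mul_agrees fF gG) hH) mulrA.
Qed.

Lemma series_mulC : commutative series_mul.
Proof.
move=> f g; apply: series_ext => m.
have [F fF] := malg_approx m f; have [G gG] := malg_approx m g.
by rewrite (series_mul_malg fF gG) (series_mul_malg gG fF) mulrC.
Qed.

Lemma series_mul1 : left_id series1 series_mul.
Proof.
move=> f; apply: series_ext => m; have [F fF] := malg_approx m f.
rewrite (series_mul_malg (@series1_agrees m) fF) mul1r fF//.
Qed.

Lemma series_mulDl : left_distributive series_mul +%R.
Proof.
move=> f g h; apply: series_ext => m.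
have [F fF] := malg_approx m f; have [G gG] := malg_approx m g.
have [H hH] := malg_approx m h.
rewrite (series_mul_malg (series_addr_agrees fF gG) hH) mulrDl mcoeffD.
by congr (_ + _); apply/esym; [apply: series_mul_malg fF hH|apply: series_mul_malg gG hH].
Qed.

Lemma series1_neq0 : series1 != 0.
Proof.
apply/eqP => /(congr1 (fun f : series => f (onecm indet)))/eqP.
by rewrite /series1 eqxx oner_eq0.
Qed.

HB.instance Definition _ := GRing.Zmodule_isComNzRing.Build series
  series_mulA series_mulC series_mul1 series_mulDl series1_neq0.

Lemma seriesME f g : f * g = series_mul f g. Proof. by []. Qed.

Lemma series1E m : (1 : series) m = (m == onecm indet)%:R. Proof. by []. Qed.

Lemma finite_factorizations m : finite_set [set p : mon * mon | mulcm p.1 p.2 = m].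
Proof.
have [X hX] := divisors_cmonom m.
apply: (@sub_finite_set _ _ [set` [seq (a, b) | a <- X, b <- X]]); last exact: finite_seq.
move=> [a b] /= abm; rewrite allpairs_f// hX// -abm.
  exact: dvdcm_mulr.
exact: dvdcm_mull.
Qed.

Lemma series_mul_neq0 f g m : (f * g) m <> 0 ->
  exists p : mon * mon, [/\ mulcm p.1 p.2 = m, f p.1 <> 0 & g p.2 <> 0].
Proof.
move=> /eqP/(@fsbigN1 _ _ _ _ _ _ (fun _ (p : mon * mon) => f p.1 * g p.2) tt).
move=> [p pm]; rewrite mulf_eq0 negb_or => /andP[/eqP fp /eqP gp].
by exists p.
Qed.

Lemma series_mul_ge0 f g :
  (forall m, 0 <= f m) -> (forall m, 0 <= g m) -> forall m, 0 <= (f * g) m.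
Proof. by move=> f0 g0 m; apply: fsumr_ge0 => p _; apply: mulr_ge0. Qed.

(** Nonnegative terms cannot cancel, and the factorization [(m1, m2)] contributes a positive one. *)
Lemma series_mul_gt0 f g m1 m2 :
  (forall m, 0 <= f m) -> (forall m, 0 <= g m) ->
  0 < f m1 -> 0 < g m2 -> 0 < (f * g) (mulcm m1 m2).
Proof.
move=> f0 g0 f1 g2; rewrite lt_neqAle series_mul_ge0// andbT eq_sym.
apply/eqP => /(pfsumr_eq0 (@finite_factorizations _)) h.
have /eqP := h (fun p _ => mulr_ge0 (f0 p.1) (g0 p.2)) (m1, m2) erefl.
by rewrite gt_eqF ?mulr_gt0.
Qed.

Lemma series_mulZ f g (c : rat) m :
  (f * (fun m => c * g m : rat)) m = c * (f * g) m.
Proof.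
by rewrite seriesME /series_mul mulr_fsumr; apply: eq_fsbigr => p _; rewrite mulrCA.
Qed.

End SeriesRing.

(** * Replacing the indeterminates by their powers *)

Section Substitution.
Local Open Scope classical_set_scope.
Local Open Scope ring_scope.
Variables (r : nat) (r_gt0 : (0 < r)%N).
Implicit Types (f g : series) (m : {cmonom indet}).

Lemma series_substX f m : series_subst r f (expcmn m r) = f m.
Proof.
rewrite /series_subst (_ : [set m' | _] = [set m]) ?fsbig_set1//.
by apply/seteqP; split=> m' /=; [move/(expcmn_inj r_gt0)|move=> ->].
Qed.

Lemma series_subst_notX f m :
  (forall m', expcmn m' r <> m) -> series_subst r f m = 0.
Proof.
move=> h; rewrite /series_subst (_ : [set m' | _] = set0) ?fsbig_set0//.
by apply/seteqP; split=> m' //= /h.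
Qed.

Lemma expcmnP m : (exists m', m = expcmn m' r) \/ (forall m', expcmn m' r <> m).
Proof.
have [|h] := pselect (exists m', m = expcmn m' r); first by left.
by right=> m' e; apply: h; exists m'.
Qed.

Lemma series_subst1 : series_subst r 1 = 1.
Proof.
have e1 : expcmn (onecm indet) r = onecm indet.
  by apply: cm_ext => i; rewrite expcmnE onecmE.
apply: series_ext => m; have [[m' ->]|h] := expcmnP m.
  rewrite series_substX !series1E; congr ((nat_of_bool _)%:R).
  by rewrite -{2}e1; apply/eqP/eqP => [->//|/(expcmn_inj r_gt0)].
rewrite series_subst_notX// series1E.
by case: (eqVneq m) => // mE; case: (h (onecm indet)); rewrite mE.
Qed.

Lemma expcmnM (m1 m2 : mon) : expcmn (mulcm m1 m2) r = mulcm (expcmn m1 r) (expcmn m2 r).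
Proof. by apply: cm_ext => i; rewrite expcmnE !mulcmE !expcmnE mulnDl. Qed.

(** Only factorizations into two r-th powers contribute. They exist only if [m] is itself an r-th
    power of some [m'], and then they are the images of the factorizations of [m']. *)
Lemma series_substM f g : series_subst r (f * g) = series_subst r f * series_subst r g.
Proof.
apply: series_ext => m; have [[m' ->]|h] := expcmnP m; last first.
  rewrite series_subst_notX//; apply/esym/fsbig1 => -[a b] /= abm.
  have [[a' aE]|ha] := expcmnP a; last by rewrite series_subst_notX// mul0r.
  have [[b' bE]|hb] := expcmnP b; last by rewrite [X in _ * X]series_subst_notX// mulr0.
  by case: (h (mulcm a' b')); rewrite expcmnM -aE -bE.
rewrite series_substX !seriesME /series_mul.
pose h (p : mon * mon) := (expcmn p.1 r, expcmn p.2 r).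
apply/esym.
rewrite -(@fsbig_widen _ _ _ _ (h @` [set p : mon * mon | mulcm p.1 p.2 = m'])
  [set p : mon * mon | mulcm p.1 p.2 = expcmn m' r]).
- rewrite fsbig_image; first by apply: eq_fsbigr => p _; rewrite /h /= !series_substX.
  move=> [a b] [a' b'] _ _ [] /(expcmn_inj r_gt0) -> /(expcmn_inj r_gt0) ->//.
- by move=> _ [p /= pm <-] /=; rewrite -expcmnM pm.
move=> [a b] /= [abm nh].
have [[a' aE]|ha] := expcmnP a; last by rewrite series_subst_notX// mul0r.
have [[b' bE]|hb] := expcmnP b; last by rewrite [X in _ * X]series_subst_notX// mulr0.
case: nh; exists (a', b'); last by rewrite /h /= -aE -bE.
by apply: (expcmn_inj r_gt0); rewrite expcmnM -aE -bE.
Qed.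

End Substitution.

(** * Newton's identities *)

Section PowerSums.
Local Open Scope classical_set_scope.
Local Open Scope ring_scope.
Implicit Types (m : {cmonom indet}) (v w : indet).

Lemma serP_ge0 d m : 0 <= serP d m.
Proof.
by apply: fsumr_ge0 => k _; apply: fsumr_ge0 => j _; rewrite mulr_ge0 ?ler0n.
Qed.

(** P_d consists of pure powers: [v] is the pair (k, j) of the defining sum and [e] is d/k. *)
Lemma serP_neq0 d m : (0 < d)%N -> serP d m <> 0 ->
  exists v e, [/\ (0 < e)%N, (val v.1 * e)%N = d & m = expcmn (ucm v) e].
Proof.
move=> d0 /eqP/(@fsbigN1 _ _ _ _ _ _ (fun _ (k : posint) =>
  \sum_(j \in [set: posint]) ((val k)%:R *
    (m == expcmn (ucm (k, j)) (d %/ val k))%:R : rat)) tt).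
move=> [k /= kd] /(@fsbigN1 _ _ _ _ _ _ (fun _ (j : posint) =>
  ((val k)%:R * (m == expcmn (ucm (k, j)) (d %/ val k))%:R : rat)) tt).
move=> [j _]; case: (eqVneq m) => [mE _|]; last by rewrite mulr0 eqxx.
exists (k, j), (d %/ val k)%N; split=> //=; last by rewrite mulnC divnK.
by rewrite divn_gt0 ?posint_gt0// dvdn_leq.
Qed.

Lemma expcmn_ucm_inj v w e c : (0 < e)%N ->
  expcmn (ucm v) e = expcmn (ucm w) c -> v = w /\ e = c.
Proof.
move=> e0 h; have := congr1 (fun m : {cmonom indet} => m v) h.
rewrite !ucmXE eqxx mul1n; have [->|_ e1] := eqVneq w v; first by rewrite mul1n.
by rewrite e1 in e0.
Qed.

Lemma serP_expcmn v e : (0 < e)%N ->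
  serP (val v.1 * e) (expcmn (ucm v) e) = (val v.1)%:R.
Proof.
case: v => k j /= e0; have k0 := posint_gt0 k.
rewrite /serP -(@fsbig_widen _ _ _ _ [set k]).
- rewrite fsbig_set1 -(@fsbig_widen _ _ _ _ [set j])//.
    by rewrite fsbig_set1 mulKn// eqxx mulr1.
  move=> j' [_ /= jj']; case: (eqVneq (expcmn _ _)) => [/expcmn_ucm_inj|]; last first.
    by rewrite mulr0.
  by move=> /(_ e0)[[/esym]].
- by move=> _ -> /=; rewrite dvdn_mulr.
move=> k' [/= _ kk']; apply: fsbig1 => j' _.
case: (eqVneq (expcmn _ _)) => [/expcmn_ucm_inj|]; last by rewrite mulr0.
by move=> /(_ e0)[[/esym]].
Qed.

(** The finitely many terms of P_d that divide [m], which form a polynomial agreeing with P_d on the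
    divisors of [m]. *)
Definition powersum_trunc d m : {malg rat[{cmonom indet}]} :=
  \sum_(v <- finsupp m) \sum_(1 <= e < (m v).+1 | (val v.1 * e == d)%N)
    << (val v.1)%:R *g expcmn (ucm v) e >>.

Lemma serP_agrees d m : (0 < d)%N -> malg_agrees m (serP d) (powersum_trunc d m).
Proof.
move=> d0 m' dv; rewrite mcoeff_sum.
under eq_bigr do rewrite mcoeff_sum.
under eq_bigr do under eq_bigr do rewrite mcoeffU.
have [P0|/eqP] := eqVneq (serP d m') 0.
  rewrite P0 big1// => v _; rewrite big_seq_cond big1// => e.
  rewrite mem_index_iota => /andP[/andP[e0 _] /eqP ve].
  by case: eqP => // mE; move: P0; rewrite -mE -ve serP_expcmn.
move=> /(serP_neq0 d0)[w [c [c0 wc mE]]]; rewrite {}mE in dv *.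
have cm : (c <= m w)%N by apply/dvdcm_ucm.
rewrite -wc serP_expcmn// (big_fsetD1 w)/=; last first.
  by rewrite -cmE_neq0 -lt0n (leq_trans c0).
rewrite [X in _ + X]big_seq [X in _ + X]big1 ?addr0; last first.
  move=> v; rewrite !inE => /andP[vw _]; rewrite big_seq_cond big1// => e.
  rewrite mem_index_iota => /andP[/andP[e0 _] _]; case: eqP => //.
  by case/(expcmn_ucm_inj e0) => vw'; rewrite vw' eqxx in vw.
rewrite big_mkcond (bigD1_seq c) ?iota_uniq ?mem_index_iota ?c0 ?ltnS//= !eqxx mulr1n.
rewrite big1 ?addr0// => e ec.
by rewrite eqn_pmul2l ?posint_gt0// (negPf ec).
Qed.

Lemma serP_mulE d (F : series) m : (0 < d)%N ->
  (serP d * F) m = \sum_(v <- finsupp m)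
    \sum_(1 <= e < (m v).+1 | (val v.1 * e == d)%N)
      (val v.1)%:R * F (divcm m (expcmn (ucm v) e)).
Proof.
move=> d0; have [G FG] := malg_approx m F.
rewrite seriesME (series_mul_malg (serP_agrees d0) FG) mulr_suml mcoeff_sum.
apply: eq_bigr => v _; rewrite mulr_suml mcoeff_sum big_nat_cond [RHS]big_nat_cond.
apply: eq_bigr => e /andP[/andP[e0 em] _].
have vm : dvdcm (expcmn (ucm v) e) m by apply/dvdcm_ucm.
rewrite (mcoeff_cmonomM _ _ vm) FG// => i.
by rewrite divcmE leq_subr.
Qed.
End PowerSums.

Lemma mon_degM (m1 m2 : {cmonom indet}) :
  mon_deg (mulcm m1 m2) = mon_deg m1 + mon_deg m2.
Proof.
apply: (@big_cmonomM indet nat 0 addn (fun v n => val v.1 * n)) => [v|v n1 n2].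
  by rewrite muln0.
by rewrite mulnDr.
Qed.

Lemma mon_deg_expcmn (v : indet) e : mon_deg (expcmn (ucm v) e) = val v.1 * e.
Proof.
elim: e => [|e IHe].
  by rewrite muln0 /mon_deg (big_cmonom1 addn (fun v n => val v.1 * n)).
rewrite expcmnS mon_degM IHe mulnS.
by rewrite {1}/mon_deg (big_cmonomU addn (fun v n => val v.1 * n)) muln1.
Qed.

(* H and E are the instances g = 1, 1, 1, ... with eps = 1 and
   g = 1, -1, 0, 0, ... with eps = -1. *)
Section MultiplicativeSeries.
Local Open Scope ring_scope.
Variables (g : nat -> rat) (eps : rat).
Hypothesis g0 : g 0%N = 1.
Hypothesis g_rec : forall a : nat, a%:R * g a = eps * \sum_(1 <= e < a.+1) g (a - e)%N.
Implicit Types (m : {cmonom indet}).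

(** The coefficient of [m] in the product, over all indeterminates x, of the series sum_a g(a) x^a;
    [mulser d] is the part of degree d of that product. *)
Definition gprod m : rat := \prod_(v <- finsupp m) g (m v).

Definition mulser (d : nat) : series := fun m => (mon_deg m == d)%:R * gprod m.

Lemma gprod_div m v e : v \in finsupp m ->
  gprod (divcm m (expcmn (ucm v) e)) =
  g (m v - e)%N * \prod_(w <- (finsupp m `\ v)%fset) g (m w).
Proof.
move=> vm; rewrite /gprod.
(* The division may remove [v] from the support; since g(0) = 1 the product can still range over the
   support of [m]. *)
rewrite (@big_cmonom_sub _ _ _ *%R (fun _ n => g n) _ (finsupp m))//; last first.
  move=> i; rewrite -!cmE_neq0 divcmE -!lt0n => /leq_trans; apply.
  exact: leq_subr.
rewrite (big_fsetD1 v)//= divcmE ucmXE eqxx mul1n; congr (_ * _).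
rewrite big_seq [RHS]big_seq; apply: eq_bigr => w; rewrite !inE => /andP[wv _].
by rewrite divcmE ucmXE eq_sym (negPf wv) subn0.
Qed.

(** Compared at each monomial: the degree of [m] is the sum of deg(v) m(v) over its indeterminates
    v, and [g_rec] rewrites m(v) g(m(v)) as a sum over e. The summand for e matches the term x_v^e
    of P_k with k = deg(v) e. *)
Lemma newton_mulser d m :
  d%:R * mulser d m = eps * \sum_(1 <= k < d.+1) (serP k * mulser (d - k)) m.
Proof.
under eq_big_nat => k /andP[k0 _] do rewrite serP_mulE//.
rewrite /mulser.
have degE v e : (e <= m v)%N ->
    mon_deg m = (val v.1 * e + mon_deg (divcm m (expcmn (ucm v) e)))%N.
  move=> em; rewrite -mon_deg_expcmn -mon_degM mulcm_div//.
  exact/dvdcm_ucm.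
(* If [m] does not have degree d, both sides vanish. *)
have [dm|dm] := eqVneq (mon_deg m) d; last first.
  rewrite mul0r mulr0 big_nat_cond big1 ?mulr0// => k /andP[/andP[k0 kd] _].
  rewrite big1// => v _; rewrite big_nat_cond big1// => e /andP[/andP[e0 em] /eqP ve].
  case: eqP => h; last by rewrite mul0r mulr0.
  by move: dm; rewrite (degE v e)// h ve subnKC ?eqxx.
rewrite mul1r exchange_big/= -dm {1}/mon_deg natr_sum mulr_suml mulr_sumr.
rewrite big_seq [RHS]big_seq; apply: eq_bigr => v vm.
rewrite {1}/gprod (big_fsetD1 v)//= natrM -mulrA (mulrA (m v)%:R) g_rec.
rewrite -mulrA mulrCA; congr (_ * _).
rewrite (exchange_big_dep_nat xpredT)//= mulr_suml mulr_sumr.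
apply: eq_big_nat => e /andP[e0 em].
have v0 := posint_gt0 v.1.
have := degE v e em; set m' := divcm _ _ => degm.
(* For fixed v and e the only contributing k is deg(v) e. *)
rewrite [RHS]big_mkcond (bigD1_seq (val v.1 * e)%N) ?iota_uniq//=; last first.
  by rewrite mem_index_iota muln_gt0 v0 e0 ltnS degm leq_addr.
rewrite eqxx [X in _ + X]big1 ?addr0; last by move=> k kv; rewrite eq_sym (negPf kv).
by rewrite degm addKn eqxx mul1r gprod_div.
Qed.

Lemma newton_mulser_subst r d : (0 < r)%N ->
  series_subst r (mulser d) *+ d =
  (fun m => eps * (\sum_(1 <= k < d.+1)
     series_subst r (serP k) * series_subst r (mulser (d - k))) m) :> series.
Proof.
move=> r0; apply: series_ext => m; rewrite series_mulnE series_sumE -mulr_natl.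
under eq_bigr do rewrite -series_substM//.
have [[m' ->]|h] := expcmnP r m.
  rewrite series_substX// newton_mulser; congr (_ * _).
  by apply: eq_bigr => k _; rewrite series_substX.
rewrite series_subst_notX// mulr0 big1 ?mulr0// => k _.
by rewrite series_subst_notX.
Qed.

End MultiplicativeSeries.

(** * The recursion for products over rows *)

Section NewtonProducts.
Local Open Scope ring_scope.
Variables (g : nat -> rat) (eps : rat).
Hypothesis g0 : g 0%N = 1.
Hypothesis g_rec : forall a : nat, a%:R * g a = eps * \sum_(1 <= e < a.+1) g (a - e)%N.
Variables (I : finType) (fac : I -> posint).
Implicit Types (e : {cmonom I}).

(** Row lengths are encoded as the exponents of a monomial [e] with one indeterminate per row, so
    that shortening row i by k is a division. The weight counts each cell with the index of its
    tensor factor. *)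
Definition rows_weight e : nat := \sum_i val (fac i) * e i.

Definition rows_series e : series :=
  \prod_i series_subst (val (fac i)) (mulser g (e i)).

Lemma rows_series_div e i k :
  rows_series (divcm e (expcmn (ucm i) k)) =
  series_subst (val (fac i)) (mulser g (e i - k)) *
  \prod_(j | j != i) series_subst (val (fac j)) (mulser g (e j)).
Proof.
rewrite /rows_series (bigD1 i)//= divcmE ucmXE eqxx mul1n; congr (_ * _).
apply: eq_bigr => j ji.
by rewrite divcmE ucmXE eq_sym (negPf ji) subn0.
Qed.

(** Each row i accounts for the summand [fac i] times [e i] of the weight; Newton's identity is
    applied to the factor of that row alone. *)
Lemma newton_rows e m :
  (rows_weight e)%:R * rows_series e m =
  eps * \sum_i \sum_(1 <= k < (e i).+1) (val (fac i))%:R *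
    (series_subst (val (fac i)) (serP k) *
       rows_series (divcm e (expcmn (ucm i) k))) m.
Proof.
rewrite natr_sum mulr_suml mulr_sumr; apply: eq_bigr => i _.
rewrite natrM -mulrA -mulr_sumr [RHS]mulrCA; congr (_ * _).
rewrite mulr_natl -series_mulnE [rows_series e]/rows_series (bigD1 i)//= -mulrnAl.
rewrite (newton_mulser_subst g0 g_rec)//; last exact: posint_gt0.
rewrite mulrC series_mulZ; congr (_ * _).
rewrite mulrC mulr_suml series_sumE; apply: eq_bigr => k _.
by rewrite -mulrA -rows_series_div.
Qed.

End NewtonProducts.

Lemma mulcmU_div (J : choiceType) (m : {cmonom J}) v :
  v \in finsupp m -> mulcm (ucm v) (divcm m (ucm v)) = m.
Proof.
move=> vm; apply: mulcm_div; apply/(dvdcm_ucm v 1).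
by rewrite lt0n cmE_neq0.
Qed.

(** * Expansion of products of rows *)

Section BlockMonomials.
Implicit Types (mu nu : {cmonom indet}) (b : indet).

(** The size of the type encoded by [mu], a block d^r counting d r; [z_mon] is its z^⊗, regrouped
    over distinct blocks. *)
Definition mon_wt mu : nat := \sum_(b <- finsupp mu) val b.1 * val b.2 * mu b.

Definition z_mon mu : nat := \prod_(b <- finsupp mu) (val b.1 ^ mu b * (mu b)`!).

Lemma mon_wtM mu nu : mon_wt (mulcm mu nu) = mon_wt mu + mon_wt nu.
Proof.
apply: (@big_cmonomM indet nat 0 addn (fun b n => val b.1 * val b.2 * n)).
  by move=> b; rewrite muln0.
by move=> b n1 n2; rewrite mulnDr.
Qed.

Lemma mon_wtU b : mon_wt (ucm b) = val b.1 * val b.2.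
Proof.
by rewrite /mon_wt (big_cmonomU addn (fun b n => val b.1 * val b.2 * n)) muln1.
Qed.

Lemma mon_wt1 : mon_wt (onecm indet) = 0.
Proof. exact: (big_cmonom1 addn (fun b n => val b.1 * val b.2 * n)). Qed.

Lemma mdegU_mul b nu : mdeg (mulcm (ucm b) nu) = (mdeg nu).+1.
Proof. by rewrite (mdegM (ucm b) nu) mdegU. Qed.

Lemma mdeg_le_mon_wt mu : mdeg mu <= mon_wt mu.
Proof.
elim/cmonom_ind: mu => [|b mu IH]; first by rewrite mdeg1.
rewrite mdegU_mul mon_wtM mon_wtU -add1n leq_add//.
by rewrite muln_gt0 !posint_gt0.
Qed.

Lemma z_mon_gt0 mu : 0 < z_mon mu.
Proof.
by apply: prodn_gt0 => b; rewrite muln_gt0 expn_gt0 posint_gt0 fact_gt0.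
Qed.

Lemma z_mon1 : z_mon (onecm indet) = 1.
Proof. exact: (big_cmonom1 muln (fun b n => val b.1 ^ n * n`!)). Qed.

(** Removing one block d^r divides z by d times the number of its copies. In [fill_coef_rec] this
    cancels against the d r mu(b) with which the block enters the weight, leaving r. *)
Lemma z_mon_div mu b : b \in finsupp mu ->
  z_mon mu = z_mon (divcm mu (ucm b)) * (val b.1 * mu b).
Proof.
move=> bmu; have mub : 0 < mu b by rewrite lt0n cmE_neq0.
rewrite /z_mon (@big_cmonom_sub _ _ _ muln (fun b n => val b.1 ^ n * n`!)
  (divcm mu (ucm b)) (finsupp mu))//; last first.
  move=> i; rewrite -!cmE_neq0 divcmE -!lt0n => /leq_trans; apply.
  exact: leq_subr.
rewrite (big_fsetD1 b)//= [LHS](big_fsetD1 b)//= divcmE ucmE eqxx subn1.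
rewrite -{1 2}(prednK mub) expnS factS prednK//.
rewrite [in RHS](eq_big_seq (fun i => val i.1 ^ mu i * (mu i)`!)).
  by rewrite /=; move: (\prod_(i <- _) _) (_ ^ _) (_.-1`!) => A x f; lia.
move=> i; rewrite !inE => /andP[ib _].
by rewrite divcmE ucmE eq_sym (negPf ib) subn0.
Qed.

(** The number n bounds the degree, the multiplicity and the number of copies of every block. *)
Lemma types_of_wt n : exists S : seq {cmonom indet},
  uniq S /\ forall mu, mon_wt mu = n -> mu \in S.
Proof.
pose ps := pmap (insub : nat -> option posint) (iota 0 n.+1).
have [S hS] := bounded_cmonoms [seq (k, r) | k <- ps, r <- ps] n.
exists (undup S); split; first exact: undup_uniq.
move=> mu wmu; rewrite mem_undup.
have le b : b \in finsupp mu -> val b.1 * val b.2 * mu b <= n.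
  by move=> bmu; rewrite -wmu /mon_wt (big_fsetD1 b)//= leq_addr.
have inps (k : posint) : val k <= n -> k \in ps.
  by move=> kn; rewrite mem_pmap_sub mem_iota add0n ltnS.
apply: hS => [b|b].
  move=> bmu; have := le b bmu.
  have : 0 < mu b by rewrite lt0n cmE_neq0.
  case: b {bmu} => k r /= mu0 h; apply: allpairs_f; apply: inps.
    by apply: leq_trans h; rewrite -mulnA leq_pmulr// muln_gt0 posint_gt0.
  by apply: leq_trans h; rewrite mulnAC mulnC leq_pmulr// muln_gt0 posint_gt0.
have [bmu|] := boolP (b \in finsupp mu); last by rewrite -cmE_eq0 => /eqP ->.
by apply: leq_trans (le _ bmu); rewrite leq_pmull// muln_gt0 !posint_gt0.
Qed.

Local Open Scope ring_scope.

Definition blockser b : series := series_subst (val b.2) (serP (val b.1)).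

(** The default value 1 is taken at 0; the arguments that matter are degrees of blocks or exponents
    in a support, which are positive. *)
Definition posint_of_nat (k : nat) : posint := insubd (exist _ 1%N (erefl true)) k.

Lemma val_posint_of_nat k : (0 < k)%N -> val (posint_of_nat k) = k.
Proof. by move=> k0; rewrite val_insubd k0. Qed.

Lemma posint_of_natK (k : posint) : posint_of_nat (val k) = k.
Proof. by apply: val_inj; rewrite val_posint_of_nat// posint_gt0. Qed.

End BlockMonomials.

(** * Coefficients of the expansion *)

Section Expansion.
Local Open Scope ring_scope.
Variables (g : nat -> rat) (eps : rat).
Hypothesis g0 : g 0%N = 1.
Hypothesis g_rec : forall a : nat, a%:R * g a = eps * \sum_(1 <= e < a.+1) g (a - e)%N.
Variables (I : finType) (fac : I -> posint).
Implicit Types (e : {cmonom I}) (mu nu : {cmonom indet}) (b : indet).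

(** A block d^r may go to any row of the r-th factor, where it takes up d cells; this is the
    generating polynomial of these choices. *)
Definition placement b : {malg rat[{cmonom I}]} :=
  \sum_(i | fac i == b.2) << expcmn (ucm i) (val b.1) >>.

(* The number of ways of distributing the blocks of mu over the rows with
   matching factors so that row i receives total degree e i. *)
Definition fillings e mu : rat := (cmeval placement mu)@_e.

Lemma fillingsU e b nu : fillings e (mulcm (ucm b) nu) =
  \sum_(i | (fac i == b.2) && (val b.1 <= e i)%N)
    fillings (divcm e (expcmn (ucm i) (val b.1))) nu.
Proof.
rewrite /fillings cmevalM cmevalU mulr_suml mcoeff_sum big_mkcondr.
apply: eq_bigr => i _; case: leqP => be.
  by rewrite mcoeff_cmonomM ?mul1r//; apply/dvdcm_ucm.
by rewrite mcoeff_cmonomM_ndvd// => /dvdcm_ucm; rewrite leqNgt be.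
Qed.

Lemma fillings1 e : fillings e (onecm indet) = (e == onecm I)%:R.
Proof. by rewrite /fillings cmeval1 mcoeff1. Qed.

Lemma rows_weight_div e i k : (k <= e i)%N ->
  rows_weight fac e =
  (k * val (fac i) + rows_weight fac (divcm e (expcmn (ucm i) k)))%N.
Proof.
move=> ke; rewrite /rows_weight (bigD1 i)//= [in RHS](bigD1 i)//= addnA.
congr (_ + _)%N; first by rewrite divcmE ucmXE eqxx mul1n (mulnC k) -mulnDr subnKC.
apply: eq_bigr => j ji.
by rewrite divcmE ucmXE eq_sym (negPf ji) subn0.
Qed.

(** A block d^r lies in a row of the r-th factor, so it contributes d r to both weights. *)
Lemma fillings_wt e mu : fillings e mu <> 0 -> mon_wt mu = rows_weight fac e.
Proof.
elim/cmonom_ind: mu e => [|b mu IH] e.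
  rewrite fillings1; case: eqP => // -> _; rewrite mon_wt1 /rows_weight big1//.
  by move=> i _; rewrite onecmE muln0.
have [[i [/eqP fi be] fn]|h] := pselect (exists i,
    [/\ fac i == b.2, (val b.1 <= e i)%N &
        fillings (divcm e (expcmn (ucm i) (val b.1))) mu <> 0]).
  by rewrite mon_wtM mon_wtU (IH _ fn) (rows_weight_div be) fi.
rewrite fillingsU big1// => i /andP[fi be].
by apply: contrapT => fn; apply: h; exists i.
Qed.

(** The candidate for the coefficient of P_mu in the product over rows. *)
Definition fill_coef e mu : rat := eps ^+ mdeg mu * fillings e mu / (z_mon mu)%:R.

Lemma fill_coef_rec e mu :
  (rows_weight fac e)%:R * fill_coef e mu =
  eps * \sum_i \sum_(1 <= k < (e i).+1) (val (fac i))%:R *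
    (if (posint_of_nat k, fac i) \in finsupp mu then
       fill_coef (divcm e (expcmn (ucm i) k)) (divcm mu (ucm (posint_of_nat k, fac i)))
     else 0).
Proof.
(* The two weights agree unless [fillings e mu] vanishes, in which case both sides are 0. *)
transitivity ((mon_wt mu)%:R * fill_coef e mu).
  have [f0|/eqP/fillings_wt -> //] := eqVneq (fillings e mu) 0.
  by rewrite /fill_coef f0 mulr0 mul0r !mulr0.
(* The contribution of a distinguished block [b] placed in row [i]. *)
pose T i b := (val b.2)%:R *
  fill_coef (divcm e (expcmn (ucm i) (val b.1))) (divcm mu (ucm b)).
transitivity (eps * \sum_i \sum_(b <- finsupp mu |
    (fac i == b.2) && (val b.1 <= e i)%N) T i b); last first.
  congr (_ * _); apply: eq_bigr => i _.
  (* Within row [i] the factor of the block is fixed, so blocks are indexed by their degree k. *)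
  transitivity (\sum_(1 <= k < (e i).+1)
      \sum_(b <- finsupp mu | b == (posint_of_nat k, fac i)) T i b).
    rewrite (exchange_big_dep xpredT)//= big_mkcond; apply: eq_bigr => b _.
    rewrite big_mkcond; case: ifP => [/andP[/eqP fi be]|h].
      rewrite (bigD1_seq (val b.1)) ?iota_uniq//=; last first.
        by rewrite mem_index_iota posint_gt0.
      rewrite posint_of_natK fi -surjective_pairing eqxx big_nat_cond big1 ?addr0//.
      move=> k /andP[/andP[k0 _] kb]; case: eqP => // h.
      by rewrite h /= val_posint_of_nat ?eqxx in kb.
    rewrite big_nat_cond big1// => k /andP[/andP[k0 ke] _]; case: eqP => // bE.
    by move: h; rewrite bE eqxx val_posint_of_nat// -ltnS ke.
  apply: eq_big_nat => k /andP[k0 ke].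
  case: ifP => h.
    rewrite big_mkcond (big_fsetD1 (posint_of_nat k, fac i))//= eqxx big1_fset ?addr0.
      by rewrite /T /= val_posint_of_nat.
    by move=> b; rewrite !inE => /andP[/negPf ->].
  rewrite mulr0 big_seq_cond big1// => b /andP[bmu /eqP bE].
  by rewrite -bE bmu in h.
(* The weight of [mu] is split over its blocks; this is the choice of the distinguished block. *)
rewrite (exchange_big_dep xpredT)//= natr_sum mulr_suml mulr_sumr.
rewrite big_seq [RHS]big_seq; apply: eq_bigr => b bmu.
rewrite -mulr_sumr /fill_coef -mulr_suml -mulr_sumr.
rewrite -{2 3}(mulcmU_div bmu) fillingsU mdegU_mul (z_mon_div bmu) !natrM exprS.
set f := \sum_(_ | _) _.
have b10 : (val b.1)%:R != 0 :> rat by rewrite pnatr_eq0 -lt0n posint_gt0.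
have mub0 : (mu b)%:R != 0 :> rat by rewrite pnatr_eq0 cmE_neq0.
have z0 : (z_mon (divcm mu (ucm b)))%:R != 0 :> rat.
  by rewrite pnatr_eq0 -lt0n z_mon_gt0.
have arith (x y z t u : rat) : x != 0 -> z != 0 -> t != 0 ->
    x * y * z * (eps * u * f / (t * (x * z))) = eps * (y * (u * f / t)).
  by move=> x0 z0' t0; field; rewrite x0 z0' t0.
exact: arith.
Qed.

Lemma series_mul_lincomb (f : series) (T : Type) (S : seq T) (c : T -> rat)
    (h : T -> series) m :
  (f * (fun m => \sum_(t <- S) c t * h t m : rat)) m =
  \sum_(t <- S) c t * (f * h t) m.
Proof.
have -> : (fun m => \sum_(t <- S) c t * h t m : rat) =
    \sum_(t <- S) (fun m => c t * h t m : rat) :> series.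
  by apply: series_ext => m'; rewrite series_sumE.
rewrite mulr_sumr series_sumE; apply: eq_bigr => t _; exact: series_mulZ.
Qed.

Lemma mulser0 : mulser g 0 = 1.
Proof.
apply: series_ext => m; rewrite series1E /mulser.
have -> : (mon_deg m == 0%N) = (m == onecm indet).
  apply/idP/eqP => [|->]; last first.
    by rewrite /mon_deg (big_cmonom1 addn (fun (v : indet) n => val v.1 * n)%N).
  rewrite sum_nat_seq_eq0 => /allP h; apply: cm_ext => v; rewrite onecmE.
  apply/eqP; rewrite cmE_eq0; apply/negP => vm.
  by have := h v vm; rewrite /= muln_eq0 eqn0Ngt posint_gt0/= cmE_eq0 vm.
case: (eqVneq m) => [->|]; last by rewrite mul0r.
by rewrite mul1r /gprod (big_cmonom1 *%R (fun _ n => g n)).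
Qed.

Lemma rows_weight_eq0 e : rows_weight fac e = 0%N -> e = onecm I.
Proof.
move=> /eqP; rewrite sum_nat_eq0 => /forallP h; apply: cm_ext => i.
have := h i; rewrite /= muln_eq0 onecmE => /orP[/eqP f0|/eqP//].
by have := posint_gt0 (fac i); rewrite /= f0.
Qed.

(** Strong induction on the weight: both sides obey the same recursion, and a positive weight can be
    cancelled. Members of [S] of any other weight have coefficient 0 by [fillings_wt]. *)
Lemma rows_series_expansion e (S : seq {cmonom indet}) m :
  uniq S -> (forall mu, mon_wt mu = rows_weight fac e -> mu \in S) ->
  rows_series g fac e m = \sum_(mu <- S) fill_coef e mu * cmeval blockser mu m.
Proof.
have [n] := ubnP (rows_weight fac e); elim: n => // n IHn in e S m *.
rewrite ltnS => en uS hS.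
have [e0|W0] := posnP (rows_weight fac e).
  have eE := rows_weight_eq0 e0.
  rewrite /rows_series big1 => [|i _]; last first.
    by rewrite eE onecmE mulser0 series_subst1// posint_gt0.
  rewrite (bigD1_seq (onecm indet))//=; last by apply: hS; rewrite mon_wt1 e0.
  rewrite cmeval1 /fill_coef mdeg1 expr0 z_mon1 fillings1 eE eqxx !mul1r.
  rewrite big1 ?addr0// => mu mu1.
  have [->|/eqP/fillings_wt] := eqVneq (fillings (onecm I) mu) 0.
    by rewrite mulr0 !mul0r.
  rewrite -eE e0 => wmu; case/eqP: mu1; apply: mdeg_eq0I; apply/eqP.
  by rewrite -leqn0 -wmu mdeg_le_mon_wt.
have W0' : (rows_weight fac e)%:R != 0 :> rat by rewrite pnatr_eq0 -lt0n.
apply: (mulfI W0'); rewrite (newton_rows g0 g_rec).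
transitivity (\sum_(mu <- S) eps * (\sum_i \sum_(1 <= k < (e i).+1) (val (fac i))%:R *
    (if (posint_of_nat k, fac i) \in finsupp mu then
       fill_coef (divcm e (expcmn (ucm i) k)) (divcm mu (ucm (posint_of_nat k, fac i)))
     else 0)) * cmeval blockser mu m); last first.
  by rewrite mulr_sumr; apply: eq_bigr => mu _; rewrite -fill_coef_rec -mulrA.
under [RHS]eq_bigr do rewrite -mulrA mulr_suml.
rewrite -mulr_sumr exchange_big/=; congr (_ * _); apply: eq_bigr => i _.
under [RHS]eq_bigr do rewrite mulr_suml.
rewrite exchange_big/=; apply: eq_big_nat => k /andP[k0 ke].
under [RHS]eq_bigr do rewrite -mulrA.
rewrite -mulr_sumr; congr (_ * _).
set b := (posint_of_nat k, fac i); set e' := divcm e _.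
have bE : series_subst (val (fac i)) (serP k) = blockser b.
  by rewrite /blockser /= val_posint_of_nat.
have We := rows_weight_div (ke : (k <= e i)%N).
have We' : (rows_weight fac e' < n)%N.
  apply: leq_trans en; rewrite We -[X in (X < _)%N]add0n ltn_add2r.
  by rewrite muln_gt0 k0 posint_gt0.
(* Removing [b] is injective on the [mu] that contain it, and every [nu] of the smaller weight
   arises by removing [b] from [nu] times [b]. *)
pose S' := [seq divcm mu (ucm b) | mu <- S & b \in finsupp mu].
have uS' : uniq S'.
  rewrite map_inj_in_uniq; first exact: filter_uniq.
  move=> mu nu; rewrite !mem_filter => /andP[bmu _] /andP[bnu _] h.
  have := congr1 (mulcm (ucm b)) h.
  by rewrite (mulcmU_div bmu) (mulcmU_div bnu).
have hS' nu : mon_wt nu = rows_weight fac e' -> nu \in S'.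
  move=> wnu; rewrite -(mulcmK (ucm b) nu); apply: map_f.
  rewrite mem_filter -cmE_neq0 mulcmE ucmE eqxx /=; apply: hS.
  by rewrite mon_wtM mon_wtU wnu We /= val_posint_of_nat.
have -> : rows_series g fac e' =
    (fun m => \sum_(nu <- S') fill_coef e' nu * cmeval blockser nu m) :> series.
  by apply: series_ext => m'; apply: IHn.
rewrite series_mul_lincomb big_map big_filter big_mkcond.
apply: eq_bigr => mu _; case: ifP => bmu; last by rewrite mul0r.
by rewrite bE -(cmevalU blockser b) -cmevalM (mulcmU_div bmu).
Qed.

End Expansion.

(** * Linear independence *)

Section Independence.
Local Open Scope ring_scope.
Implicit Types (m mu nu : {cmonom indet}) (b v : indet).

(* The degree of a monomial m is bounded by that of any mu such that m occurs
   in P_mu, and shape m is the only mu for which equality holds. *)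
Definition support_deg m : nat := (\sum_(v <- finsupp m) val v.1)%N.

Definition shape m : {cmonom indet} :=
  \big[@mulcm indet/onecm indet]_(v <- finsupp m) ucm (v.1, posint_of_nat (m v)).

(** A block d^r counts d here, not d r as in [mon_wt], just as [support_deg] ignores exponents. *)
Definition block_deg mu : nat := (\sum_(b <- finsupp mu) val b.1 * mu b)%N.

Lemma block_degUM b nu : block_deg (mulcm (ucm b) nu) = (val b.1 + block_deg nu)%N.
Proof.
rewrite /block_deg (@big_cmonomM _ _ _ addn (fun b n => val b.1 * n)%N).
- by rewrite (big_cmonomU addn (fun b n => val b.1 * n)%N) muln1.
- by move=> i; rewrite muln0.
by move=> i n1 n2; rewrite mulnDr.
Qed.

Lemma finsupp_expcmnM v k m : (0 < k)%N ->
  finsupp (mulcm (expcmn (ucm v) k) m) =i [predU1 v & finsupp m].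
Proof.
move=> k0 w; rewrite !inE -!cmE_neq0 mulcmE ucmXE addn_eq0 negb_and muln_eq0 eqb0.
by rewrite negb_or negbK -lt0n k0 andbT eq_sym.
Qed.

Lemma big_finsupp_fresh (R : Type) (idx : R) (op : Monoid.com_law idx)
    (F : indet -> nat -> R) v k m :
  (0 < k)%N -> v \notin finsupp m ->
  \big[op/idx]_(w <- finsupp (mulcm (expcmn (ucm v) k) m))
    F w (mulcm (expcmn (ucm v) k) m w) =
  op (F v k) (\big[op/idx]_(w <- finsupp m) F w (m w)).
Proof.
move=> k0 vm; rewrite (perm_big (v :: finsupp m)) => [|]; last first.
  apply: uniq_perm; rewrite /= ?vm ?fset_uniq// => w.
  by rewrite finsupp_expcmnM// !inE.
rewrite big_cons mulcmE ucmXE eqxx mul1n.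
move: vm; rewrite -cmE_eq0 => /eqP vm0; rewrite vm0 addn0; congr (op _ _).
rewrite big_seq [RHS]big_seq; apply: eq_bigr => w wm.
rewrite mulcmE ucmXE; case: (eqVneq v w) => // vw.
by move: wm; rewrite -cmE_neq0 -vw vm0.
Qed.

Lemma blockser_ge0 b m : 0 <= blockser b m.
Proof. by apply: fsumr_ge0 => m' _; apply: serP_ge0. Qed.

Lemma cmeval_blockser_ge0 mu m : 0 <= cmeval blockser mu m.
Proof.
elim/cmonom_ind: mu m => [|b mu IH] m; first by rewrite cmeval1 series1E ler0n.
rewrite cmevalM cmevalU; apply: series_mul_ge0 => // m'.
exact: blockser_ge0.
Qed.

Lemma expcmnX (J : choiceType) (m : {cmonom J}) e r :
  expcmn (expcmn m e) r = expcmn m (e * r).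
Proof. by apply: cm_ext => i; rewrite !expcmnE mulnA. Qed.

Lemma blockser_neq0 b m : blockser b m <> 0 ->
  exists v e, [/\ (0 < e)%N, (val v.1 * e)%N = val b.1 &
    m = expcmn (ucm v) (e * val b.2)].
Proof.
have b2 := posint_gt0 b.2.
have [[m' ->]|h] := expcmnP (val b.2) m; last by rewrite /blockser series_subst_notX.
rewrite /blockser series_substX// => /(serP_neq0 (posint_gt0 _))[v [e [e0 ve ->]]].
by exists v, e; rewrite expcmnX.
Qed.

(** Induction on [mu]: a block d^r contributes some x_v^(e r) with deg(v) e = d, which raises
    [support_deg] by at most deg(v), hence by at most d. Equality forces v to be new and e = 1, and
    then the block is read off from x_v^r. *)
Lemma cmeval_blockser_neq0 mu m : cmeval blockser mu m <> 0 ->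
  (support_deg m <= block_deg mu)%N /\
  (support_deg m = block_deg mu -> shape m = mu).
Proof.
elim/cmonom_ind: mu m => [|b mu IH] m.
  rewrite cmeval1 series1E; case: eqP => // -> _.
  rewrite /support_deg /shape (big_cmonom1 addn (fun (v : indet) _ => val v.1)).
  by rewrite (big_cmonom1 (@mulcm indet) (fun (v : indet) n => ucm (v.1, posint_of_nat n))).
rewrite cmevalM cmevalU => /series_mul_neq0[[a m'] /= [<- ab /IH[le eq]]].
have [v [e [e0 ve aE]]] := blockser_neq0 ab.
rewrite block_degUM {}aE {ab}.
have k0 : (0 < e * val b.2)%N by rewrite muln_gt0 e0 posint_gt0.
(* If v already occurs, the support does not grow, and the inequality is strict because d is
   positive. *)
have [vm|vm] := boolP (v \in finsupp m').
  suff -> : support_deg (mulcm (expcmn (ucm v) (e * val b.2)) m') = support_deg m'.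
    have b1 := posint_gt0 b.1.
    split=> [|h]; first exact: leq_trans (leq_addl _ _).
    by move: le; rewrite h leqNgt -[X in (X < _)%N]add0n ltn_add2r b1.
  apply: perm_big; apply: uniq_perm; rewrite ?fset_uniq// => w.
  by rewrite finsupp_expcmnM// !inE; case: eqP => // ->; rewrite vm.
rewrite /support_deg /shape.
rewrite (big_finsupp_fresh addn (fun v _ => val v.1))//.
rewrite (big_finsupp_fresh (@mulcm indet) (fun v n => ucm (v.1, posint_of_nat n)))//=.
have vb : (val v.1 <= val b.1)%N by rewrite -ve leq_pmulr.
split=> [|h]; first exact: leq_add.
have e1 : e = 1%N.
  have v0 := posint_gt0 v.1.
  have : (val v.1 = val b.1)%N.
    by apply/eqP; rewrite eqn_leq vb/= -(leq_add2r (block_deg mu)) -h leq_add2l.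
  by rewrite -ve -[X in X = _]muln1 => /eqP; rewrite eqn_pmul2l// => /eqP.
rewrite e1 muln1 in ve; rewrite e1 mul1n posint_of_natK.
have vb1 : v.1 = b.1 by apply: val_inj.
rewrite vb1 -surjective_pairing -[in RHS]eq//.
by apply/eqP; move/eqP: h; rewrite ve eqn_add2l.
Qed.

Lemma blockser_gt0 b j : 0 < blockser b (expcmn (ucm (b.1, j)) (val b.2)).
Proof.
rewrite /blockser series_substX ?posint_gt0//.
have := @serP_expcmn (b.1, j) 1 isT; rewrite /= muln1 => h.
by rewrite [X in 0 < X]h ltr0n posint_gt0.
Qed.

(** Each block d^r is given an indeterminate x_(d,j) of its own, raised to the power r; positivity
    holds because all coefficients are nonnegative. *)
Lemma shape_surj mu :
  exists m, [/\ shape m = mu, support_deg m = block_deg mu &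
    0 < cmeval blockser mu m].
Proof.
elim/cmonom_ind: mu => [|b mu [m [mE mD m0]]].
  exists (onecm indet); rewrite /shape /support_deg /block_deg.
  rewrite (big_cmonom1 addn (fun (v : indet) _ => val v.1)).
  rewrite (big_cmonom1 (@mulcm indet) (fun (v : indet) n => ucm (v.1, posint_of_nat n))).
  rewrite (big_cmonom1 addn (fun (v : indet) n => val v.1 * n)%N).
  by rewrite cmeval1 series1E eqxx ltr01.
(* Exceeding the sum of the second indices in [m], [j] differs from each of them. *)
pose j := posint_of_nat (\sum_(v <- finsupp m) val v.2).+1.
have fresh : (b.1, j) \notin finsupp m.
  apply/negP => bm; have : (val j <= \sum_(v <- finsupp m) val v.2)%N.
    by rewrite (big_fsetD1 _ bm)/= leq_addr.
  by rewrite val_posint_of_nat// ltnn.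
have b2 := posint_gt0 b.2.
exists (mulcm (expcmn (ucm (b.1, j)) (val b.2)) m); split.
- rewrite /shape (big_finsupp_fresh (@mulcm indet) (fun v n => ucm (v.1, posint_of_nat n)))//=.
  by rewrite posint_of_natK -surjective_pairing -[in RHS]mE.
- rewrite /support_deg (big_finsupp_fresh addn (fun v _ => val v.1))//.
  by rewrite block_degUM -mD.
rewrite cmevalM cmevalU; apply: series_mul_gt0 => //.
- exact: blockser_ge0.
- exact: cmeval_blockser_ge0.
exact: blockser_gt0.
Qed.

(** Downward induction on [block_deg]: at a monomial of shape [mu] chosen by [shape_surj], the other
    P_nu that do not vanish have larger [block_deg], so their coefficients are already known to be
    0. *)
Lemma cmeval_blockser_free (S : seq {cmonom indet}) (a : {cmonom indet} -> rat) :
  uniq S -> (forall m, \sum_(mu <- S) a mu * cmeval blockser mu m = 0) ->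
  {in S, forall mu, a mu = 0}.
Proof.
(* [N] exceeds every [block_deg] in [S], so the induction starts vacuously. *)
move=> uS hS; pose N := (\sum_(mu <- S) block_deg mu).+1.
suff main k mu : mu \in S -> (N <= block_deg mu + k)%N -> a mu = 0.
  by move=> mu muS; apply: (main N mu muS); rewrite leq_addl.
elim: k mu => [|k IHk] mu muS.
  by rewrite addn0 /N (big_rem mu)//= ltnNge leq_addr.
rewrite addnS => hN.
have [m [mE mD m0]] := shape_surj mu.
have := hS m; rewrite (bigD1_seq mu)//= big_seq_cond big1 => [|nu /andP[nuS numu]].
  by move/eqP; rewrite addr0 mulf_eq0 (gt_eqF m0) orbF => /eqP.
have [->|/eqP nu0] := eqVneq (cmeval blockser nu m) 0; first by rewrite mulr0.
have [le eq] := cmeval_blockser_neq0 nu0.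
rewrite (IHk nu)// ?mul0r//; apply: leq_trans hN _.
rewrite -addSn leq_add2r ltn_neqAle -mD le andbT.
by apply: contra numu => /eqP/eq; rewrite mE => ->.
Qed.

End Independence.

(** * Types as monomials *)

Section TypesAsMonomials.
Implicit Types (tau : parttype) (mu : {cmonom indet}).

Definition block_indet (x : nat * posint) : indet := (posint_of_nat x.1, x.2).

Definition type_mon tau : {cmonom indet} :=
  \big[@mulcm indet/onecm indet]_(x <- blocks tau) ucm (block_indet x).

Lemma perm_blocks tau :
  perm_eq (blocks tau) [seq (d, r) | r <- finsupp tau, d <- val (tau r)].
Proof. by apply: perm_allpairs_dep => //; rewrite perm_sort. Qed.

Lemma partition_gt0 (l : intpart) d : d \in val l -> 0 < d.
Proof.
by case: l => l /= /andP[_ l0]; rewrite lt0n; apply: contraTneq => ->.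
Qed.

Lemma blocks_gt0 tau x : x \in blocks tau -> 0 < x.1.
Proof.
rewrite (perm_mem (perm_blocks tau)) => /allpairsPdep[r [d [_ dr ->]]].
exact: partition_gt0 dr.
Qed.

Lemma parttype_outdom tau r : r \notin finsupp tau -> val (tau r) = [::].
Proof. by move=> /fsfun_dflt ->. Qed.

Lemma count_blocks tau d r : count_mem (d, r) (blocks tau) = count_mem d (val (tau r)).
Proof.
rewrite (permP (perm_blocks tau)) count_flatten sumnE !big_map.
rewrite (eq_bigr (fun r' => (r' == r) * count_mem d (val (tau r')))); last first.
  move=> r' _; rewrite count_map; case: (eqVneq r' r) => [->|rr].
    by rewrite mul1n; apply: eq_count => d' /=; rewrite xpair_eqE eqxx andbT.
  rewrite mul0n; apply/eqP; rewrite -leqn0 leqNgt -has_count; apply/hasPn => d' _ /=.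
  by rewrite xpair_eqE (negPf rr) andbF.
have [rt|rt] := boolP (r \in finsupp tau).
  rewrite (big_fsetD1 r)//= eqxx mul1n big1_fset ?addn0// => r'.
  by rewrite !inE => /andP[/negPf ->].
rewrite (parttype_outdom rt) big_seq big1// => r' rt'.
by case: eqP => // rr; rewrite -rr rt' in rt.
Qed.

Lemma intpart_inj (l1 l2 : intpart) :
  (forall d, count_mem d (val l1) = count_mem d (val l2)) -> l1 = l2.
Proof.
move=> h; apply: val_inj; apply: (@sorted_eq _ geq).
- by move=> a b c /= ba ac; apply: leq_trans ac ba.
- by move=> a b /= /andP[ba ab]; apply/eqP; rewrite eqn_leq ab.
- by case: (l1) => ? /= /andP[].
- by case: (l2) => ? /= /andP[].
by apply/allP => d _ /=; rewrite h.
Qed.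

Lemma big_ucmE (s : seq indet) b :
  (\big[@mulcm indet/onecm indet]_(x <- s) ucm x) b = count_mem b s.
Proof.
rewrite big_mulcmE.
elim: s => [|x s IH]; first by rewrite big_nil.
by rewrite big_cons IH ucmE.
Qed.

Lemma type_monE tau b : type_mon tau b = count_mem (val b.1) (val (tau b.2)).
Proof.
rewrite /type_mon -(big_map block_indet xpredT (fun x => ucm x)) big_ucmE.
rewrite count_map -count_blocks; apply: eq_in_count => -[d r] dr /=.
have d0 := blocks_gt0 dr; case: b => k r'; rewrite /block_indet !xpair_eqE /=.
congr (_ && _); apply/eqP/eqP => [<-|->]; first by rewrite val_posint_of_nat.
by rewrite posint_of_natK.
Qed.

Lemma type_mon_inj : injective type_mon.
Proof.
move=> tau rho h; apply/fsfunP => r; apply: intpart_inj => d.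
have [->|d0] := posnP d.
  by rewrite !(count_memPn _)//; apply/negP => /partition_gt0.
by have := type_monE tau (posint_of_nat d, r); rewrite h type_monE /= val_posint_of_nat.
Qed.

Lemma cmonom_list mu :
  exists s, mu = \big[@mulcm indet/onecm indet]_(x <- s) ucm x.
Proof.
elim/cmonom_ind: mu => [|b mu [s ->]]; first by exists [::]; rewrite big_nil.
by exists (b :: s); rewrite big_cons.
Qed.

Lemma type_mon_surj mu : exists tau, type_mon tau = mu.
Proof.
have [s ->] := cmonom_list mu.
(* The r-th partition collects the degrees of the blocks of multiplicity r. *)
pose l (r : posint) := sort geq [seq val b.1 | b <- s & b.2 == r].
have lP r : is_partition (l r).
  apply/andP; split; first by apply: sort_sorted => a b; exact: leq_total.
  by rewrite mem_sort; apply/mapP => -[b _] /esym/eqP; rewrite eqn0Ngt posint_gt0.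
pose tau : parttype :=
  [fsfun r in seq_fset tt [seq b.2 | b <- s] => exist _ (l r) (lP r) : intpart | part0].
have tauE r : val (tau r) = l r.
  rewrite fsfunE seq_fsetE; case: ifP => // rs /=; rewrite /l.
  rewrite (_ : [seq b <- s | b.2 == r] = [::])//.
  apply/eqP; rewrite -[_ == _]negbK -has_filter; apply/negP => /hasP[b bs /eqP br].
  by move/negP: rs; apply; rewrite -br; apply: map_f.
exists tau; apply: cm_ext => b.
rewrite type_monE big_ucmE tauE /l (permP (permEl (perm_sort _ _))) count_map.
rewrite count_filter; apply: eq_count => -[k r] /=; case: b => k' r' /=.
by rewrite xpair_eqE /= val_eqE.
Qed.

(** The support consists of the distinct blocks, grouped here by multiplicity and then by distinct
    part, as in [z_type]. *)
Lemma big_type_mon (R : Type) (idx : R) (op : Monoid.com_law idx)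
    (F : indet -> nat -> R) tau :
  \big[op/idx]_(b <- finsupp (type_mon tau)) F b (type_mon tau b) =
  \big[op/idx]_(r <- finsupp tau) \big[op/idx]_(d <- undup (val (tau r)))
    F (posint_of_nat d, r) (count_mem d (val (tau r))).
Proof.
pose s := [seq ((posint_of_nat d, r) : indet) | r <- finsupp tau, d <- undup (val (tau r))].
rewrite (perm_big s).
  rewrite big_allpairs_dep; apply: eq_bigr => r _.
  apply: eq_big_seq => d; rewrite mem_undup => dr.
  by rewrite type_monE /= val_posint_of_nat// (partition_gt0 dr).
apply: uniq_perm; rewrite ?fset_uniq//.
  apply: allpairs_uniq_dep; rewrite ?fset_uniq//; first by move=> r _; exact: undup_uniq.
  move=> _ _ /allpairsPdep[r [d [_ dr ->]]] /allpairsPdep[r' [d' [_ dr' ->]]] /= [dd rr].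
  move: dr dr'; rewrite !mem_undup => /partition_gt0 d0 /partition_gt0 d0'.
  have := congr1 val dd; rewrite !val_posint_of_nat// => ->; by rewrite rr.
move=> b; rewrite -cmE_neq0 type_monE -lt0n -has_count has_pred1.
apply/idP/allpairsPdep => [bt|[r [d [rt dr ->]]]]; last first.
  by rewrite mem_undup in dr; rewrite /= val_posint_of_nat// (partition_gt0 dr).
exists b.2, (val b.1); split; rewrite ?mem_undup// ?posint_of_natK -?surjective_pairing//.
by apply: contraLR bt => /parttype_outdom ->.
Qed.

Lemma mon_wt_type tau : mon_wt (type_mon tau) = type_size tau.
Proof.
rewrite /type_mon (big_morph _ mon_wtM mon_wt1) (perm_big _ (perm_blocks tau)).
rewrite big_allpairs_dep; apply: eq_bigr => r _.
rewrite sumnE big_distrr; apply: eq_big_seq => d dr.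
by rewrite mon_wtU /= val_posint_of_nat ?(partition_gt0 dr)// mulnC.
Qed.

Lemma mdeg_type_mon tau : mdeg (type_mon tau) = type_length tau.
Proof.
rewrite /type_mon (big_morph _ (@mdegM indet) (@mdeg1 indet)).
rewrite (perm_big _ (perm_blocks tau)) big_allpairs_dep.
apply: eq_bigr => r _; under eq_bigr do rewrite mdegU.
by rewrite sum1_size.
Qed.

Lemma z_mon_type tau : z_mon (type_mon tau) = z_type tau.
Proof.
rewrite /z_mon (big_type_mon muln (fun b n => val b.1 ^ n * n`!)).
apply: eq_bigr => r _; rewrite /z_part.
apply: eq_big_seq => d; rewrite mem_undup => dr.
by rewrite val_posint_of_nat// (partition_gt0 dr).
Qed.

Lemma ser_type_prod (F : nat -> series) tau :
  ser_type F tau = (\prod_(x <- blocks tau) series_subst (val x.2) (F x.1))%R.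
Proof. by []. Qed.

Lemma cmeval_type_mon tau : cmeval blockser (type_mon tau) = ser_type serP tau.
Proof.
rewrite ser_type_prod /type_mon -(big_map block_indet xpredT (fun x => ucm x)).
rewrite cmeval_prod big_map; apply: eq_big_seq => x xt.
by rewrite /blockser /= val_posint_of_nat// (blocks_gt0 xt).
Qed.

End TypesAsMonomials.

(** * Counting tabloids *)

Section RowFillings.
(* C is a set of cells, arranged in left-justified rows of lengths len i. *)
Variables (I C : finType) (row : C -> I) (col : C -> nat) (len : I -> nat).
Hypothesis col_lt : forall c, col c < len (row c).
Hypothesis cell_at : forall i j, j < len i -> exists c, row c = i /\ col c = j.
Hypothesis cell_inj : forall c c', row c = row c' -> col c = col c' -> c = c'.
Variables (s : nat) (d : 'I_s -> nat).
Hypothesis d_gt0 : forall l, 0 < d l.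
Implicit Types (phi : {ffun 'I_s -> I}) (T : {ffun 'I_s -> {set C}}).

Definition fills phi : bool := [forall i, \sum_(l | phi l == i) d l == len i].

(** The column at which brick k starts if it lies in row i, since bricks are laid from left to right
    in label order. *)
Definition offset phi i k : nat := \sum_(l : 'I_s | (phi l == i) && (l < k)) d l.

Definition tabloid phi : {ffun 'I_s -> {set C}} :=
  [ffun l => [set c | (row c == phi l) &&
    (offset phi (phi l) l <= col c < offset phi (phi l) l + d l)]].

Lemma offset_homo phi i k k' : k <= k' -> offset phi i k <= offset phi i k'.
Proof.
move=> kk'; rewrite /offset [leqRHS](bigID (fun l : 'I_s => l < k))/=.
rewrite [X in _ <= X + _](eq_bigl (fun l : 'I_s => (phi l == i) && (l < k))).
  exact: leq_addr.
move=> l; rewrite -andbA; congr (_ && _); case: (ltnP l k) => lk; rewrite ?andbF//.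
by rewrite (leq_trans lk).
Qed.

Lemma offset_total phi i : offset phi i s = \sum_(l | phi l == i) d l.
Proof. by apply: eq_bigl => l; rewrite ltn_ord andbT. Qed.

Lemma offsetS phi (l : 'I_s) :
  offset phi (phi l) l.+1 = offset phi (phi l) l + d l.
Proof.
rewrite /offset (bigD1 l)/= ?eqxx ?ltnSn// addnC; congr (_ + _).
apply: eq_bigl => l'; rewrite ltnS -andbA; congr (_ && _).
by rewrite [RHS]ltn_neqAle andbC.
Qed.

Lemma offsetS_neq phi (l : 'I_s) i : phi l != i -> offset phi i l.+1 = offset phi i l.
Proof.
move=> li; apply: eq_bigl => l'; rewrite ltnS leq_eqVlt.
by case: (eqVneq (l' : nat) l) => [/ord_inj ->|//]; rewrite (negPf li).
Qed.

Lemma card_row_interval i a b : b <= len i ->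
  #|[set c | (row c == i) && (a <= col c < b)]| = b - a.
Proof.
move=> bi; rewrite -sum1_card.
(* [inord] asks for a bound of successor form, hence [(len i).+1]. *)
have colP c : c \in [set c | (row c == i) && (a <= col c < b)] ->
    col c < (len i).+1.
  by rewrite inE => /andP[/eqP <- _]; rewrite ltnS ltnW.
rewrite (partition_big (fun c => inord (col c) : 'I_(len i).+1)
  (fun j => a <= j < b))/=; last first.
  by move=> c cA; rewrite inordK ?colP//; move: cA; rewrite inE => /andP[].
rewrite (eq_bigr (fun=> 1)) => [|j /andP[aj jb]].
  rewrite -(big_mkord (fun j => a <= j < b) (fun=> 1)).
  have [ab|/ltnW ba] := leqP a b; last first.
    rewrite (eqP (_ : b - a == 0)) ?subn_eq0// big1// => j /andP[aj jb].
    by have := leq_ltn_trans aj jb; rewrite ltnNge ba.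
  rewrite -[RHS]muln1 -sum_nat_const_nat (big_nat_widenl a 0)//.
  by rewrite (big_nat_widen _ b (len i).+1)//; apply: leq_trans bi _.
have [c [ci cj]] := cell_at (leq_trans jb bi).
rewrite (big_pred1 c)// => c'; rewrite !inE.
apply/andP/eqP => [[/andP[/eqP c'i c'b] /eqP h]|->].
  apply: cell_inj; rewrite ?ci// cj -h inordK// ltnS -c'i ltnW//.
by rewrite ci eqxx cj aj jb; split=> //; apply/eqP/val_inj; rewrite /= inordK.
Qed.

Section FromFilling.
Variable phi : {ffun 'I_s -> I}.
Hypothesis phi_fills : fills phi.

Lemma offset_le_len i k : offset phi i k <= len i.
Proof.
rewrite -(eqP (forallP phi_fills i)) -offset_total.
have [ks|/ltnW sk] := leqP k s; first exact: offset_homo.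
by rewrite (eq_leq _)//; apply: eq_bigl => l; rewrite ltn_ord (leq_trans _ sk).
Qed.

Lemma card_tabloid l : #|tabloid phi l| = d l.
Proof. by rewrite ffunE card_row_interval ?addKn// -offsetS offset_le_len. Qed.

Lemma tabloid_row l c : c \in tabloid phi l -> row c = phi l.
Proof. by rewrite ffunE inE => /andP[/eqP]. Qed.

Lemma tabloid_order l l' c c' : c \in tabloid phi l -> c' \in tabloid phi l' ->
  l < l' -> row c = row c' -> col c < col c'.
Proof.
rewrite !ffunE !inE => /andP[/eqP -> /andP[_ h1]] /andP[/eqP -> /andP[h2 _]] ll' rr.
apply: leq_trans h1 (leq_trans _ h2); rewrite -offsetS rr; exact: offset_homo.
Qed.

Lemma tabloid_disjoint l l' c : c \in tabloid phi l -> c \in tabloid phi l' -> l = l'.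
Proof.
move=> cl cl'; apply: val_inj; case: (ltngtP l l') => // h.
  by have := tabloid_order cl cl' h erefl; rewrite ltnn.
by have := tabloid_order cl' cl h erefl; rewrite ltnn.
Qed.

Lemma tabloid_cover c : exists l, c \in tabloid phi l.
Proof.
(* For the least such k, which is positive, brick k - 1 moves the offset past the column of [c];
   hence it lies in the row of [c] and covers [c]. *)
have ex : exists k, (k <= s) && (col c < offset phi (row c) k).
  by exists s; rewrite leqnn offset_total (eqP (forallP phi_fills _)) col_lt.
have [[|k] /andP[ks ck] kmin] := ex_minnP ex.
  by rewrite /offset big_pred0 in ck => //; move=> l; rewrite ltn0 andbF.
have ck' : offset phi (row c) k <= col c.
  by rewrite leqNgt; apply/negP => h; have := kmin k; rewrite h ltnW// ltnn => /(_ isT).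
pose l := Ordinal ks; exists l; rewrite ffunE inE.
have [lc|lc] := eqVneq (phi l) (row c); last first.
  by have := offsetS_neq lc; rewrite /= => h; move: ck; rewrite h ltnNge ck'.
by rewrite -offsetS lc ck'.
Qed.
End FromFilling.

Lemma tabloid_inj phi phi' : fills phi -> fills phi' ->
  tabloid phi = tabloid phi' -> phi = phi'.
Proof.
move=> f f' h; apply/ffunP => l.
have : 0 < #|tabloid phi l| by rewrite card_tabloid.
case/card_gt0P => c cl; rewrite -(tabloid_row cl).
by rewrite h in cl; rewrite (tabloid_row cl).
Qed.

Section ToFilling.
Variables (phi : {ffun 'I_s -> I}) (T : {ffun 'I_s -> {set C}}).
Hypothesis T_row : forall l c, c \in T l -> row c = phi l.
Hypothesis T_disjoint : forall l l' c, c \in T l -> c \in T l' -> l = l'.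
Hypothesis T_cover : forall c, exists l, c \in T l.
Hypothesis T_card : forall l, #|T l| = d l.
Hypothesis T_order : forall (l l' : 'I_s) c c',
  c \in T l -> c' \in T l' -> l < l' -> row c = row c' -> col c < col c'.

Lemma card_by_brick (B : {set C}) : #|B| = \sum_l #|T l :&: B|.
Proof.
under eq_bigr do rewrite -sum1_card.
rewrite (exchange_big_dep (mem B))/= => [|l c _]; last by rewrite inE => /andP[].
rewrite -sum1_card; apply: eq_bigr => c cB.
have [l cl] := T_cover c; rewrite (big_pred1 l)// => l'.
rewrite inE cB andbT /=; apply/idP/eqP => [cl'|->//]; exact: T_disjoint cl' cl.
Qed.

Lemma bricks_fill : fills phi.
Proof.
apply/forallP => i; apply/eqP.
have <- : #|[set c | (row c == i) && (0 <= col c < len i)]| = len i.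
  by rewrite card_row_interval ?subn0.
rewrite card_by_brick big_mkcond; apply: eq_bigr => l _.
case: eqP => [li|li].
  rewrite (finset.setIidPl _) ?T_card//; apply/fintype.subsetP => c cl.
  by rewrite inE -li (T_row cl) eqxx/= -(T_row cl) col_lt.
apply/esym/eqP; rewrite cards_eq0; apply/eqP/finset.setP => c; rewrite !inE.
by apply/negP => /andP[/T_row -> /andP[/eqP]].
Qed.

(** The cells to the left of a cell [c] of brick l are all bricks of smaller label in that row and
    some cells of brick l other than [c]. This bounds the column of [c] on both sides, and the
    inclusion is an equality by cardinality. *)
Lemma bricks_tabloid : T = tabloid phi.
Proof.
apply/ffunP => l; apply/eqP; rewrite eqEcard card_tabloid ?bricks_fill// T_card leqnn andbT.
apply/fintype.subsetP => c cl; have rc := T_row cl.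
pose B := [set c' | (row c' == row c) && (0 <= col c' < col c)].
have BE : #|B| = col c by rewrite card_row_interval ?subn0// ltnW.
have cB : c \notin B by rewrite inE ltnn !andbF.
have lB : #|T l :&: B| < d l.
  rewrite -T_card; apply: proper_card; rewrite properE finset.subsetIl/=.
  by apply/fintype.subsetPn; exists c => //; rewrite inE (negPf cB) andbF.
suff BlE : #|B| = offset phi (row c) l + #|T l :&: B|.
  by rewrite ffunE inE rc eqxx/= -rc -BE BlE leq_addr ltn_add2l.
rewrite card_by_brick (bigD1 l)//= addnC; congr (_ + _).
rewrite /offset [LHS]big_mkcond [RHS]big_mkcond; apply: eq_bigr => l' _.
(* A brick of larger label does not meet [B]; one of smaller label lies inside [B] if it is in the
   row of [c], and misses it otherwise. *)
case: (ltngtP l' l) => [ll'|ll'|/val_inj ->]; last first.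
- by rewrite eqxx andbF.
- rewrite andbF; case: ifP => // _; apply/eqP; rewrite cards_eq0.
  apply/eqP/finset.setP => c'; rewrite !inE; apply/negP => /andP[c'l' /andP[/eqP rr h]].
  by have := ltn_trans (T_order cl c'l' ll' (esym rr)) h; rewrite ltnn.
rewrite andbT (_ : l' != l); last by apply: contraTneq ll' => ->; rewrite ltnn.
case: eqP => [l'c|l'c].
  rewrite (finset.setIidPl _) ?T_card//; apply/fintype.subsetP => c' cl'.
  by rewrite inE (T_row cl') l'c eqxx/= (T_order cl' cl ll')// (T_row cl').
apply/eqP; rewrite cards_eq0; apply/eqP/finset.setP => c'; rewrite !inE.
by apply/negP => /andP[/T_row -> /andP[/eqP]].
Qed.
End ToFilling.

End RowFillings.

(** * The rows of a tensor diagram and its tabloids *)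

Section Rows.
Variable sigma : parttype.

Definition rows : seq (posint * nat) :=
  [seq (r, i) | r <- finsupp sigma, i <- iota 0 (size (val (sigma r)))].

Definition tensor_row := seq_sub rows.

Definition row_fac (i : tensor_row) : posint := (val i).1.

Definition row_len (i : tensor_row) : nat := nth 0 (val (sigma (val i).1)) (val i).2.

Lemma rows_uniq : uniq rows.
Proof.
apply: allpairs_uniq_dep; rewrite ?fset_uniq//; first by move=> r _; exact: iota_uniq.
by move=> [r i] [r' i'] _ _ /= [-> ->].
Qed.

Lemma mem_cells r i j : ((r, (i, j)) \in cells sigma) =
  ((r, i) \in rows) && (j < nth 0 (val (sigma r)) i).
Proof.
apply/allpairsPdep/andP => [[r' [ij [rs /allpairsPdep[i' [j' []]]]]]|].
  rewrite !mem_iota /= => hi hj -> [-> -> ->]; split=> //.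
  by apply: (allpairs_f_dep _ rs); rewrite mem_iota.
move=> [/allpairsPdep[r' [i' [rs hi [-> ->]]]] hj].
exists r', (i', j); split=> //; apply: allpairs_f_dep => //.
by rewrite mem_iota.
Qed.

Lemma cell_row_subproof (c : cell sigma) : (cell_factor c, cell_row c) \in rows.
Proof.
by case: c => -[r [i j]] h; have := h; rewrite mem_cells => /andP[].
Qed.

Definition row_of (c : cell sigma) : tensor_row := SeqSub (cell_row_subproof c).

Lemma same_rowE (c c' : cell sigma) : same_row c c' = (row_of c == row_of c').
Proof. by rewrite -val_eqE /= xpair_eqE. Qed.

Lemma cell_col_lt (c : cell sigma) : cell_col c < row_len (row_of c).
Proof. by case: c => -[r [i j]] h; have := h; rewrite mem_cells => /andP[]. Qed.

Lemma cell_exists (i : tensor_row) j : j < row_len i ->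
  exists c : cell sigma, row_of c = i /\ cell_col c = j.
Proof.
case: i => -[r i] h hj; have hc : (r, (i, j)) \in cells sigma by rewrite mem_cells h.
by exists (SeqSub hc); split=> //; apply: val_inj.
Qed.

Lemma cell_eq (c c' : cell sigma) :
  row_of c = row_of c' -> cell_col c = cell_col c' -> c = c'.
Proof.
case: c c' => -[r [i j]] h [[r' [i' j']] h'] /(congr1 val).
rewrite /row_of /cell_factor /cell_row /cell_col /= => -[rr ii] jj.
by apply: val_inj; rewrite /= rr ii jj.
Qed.

(** Rows of the tensor diagram correspond to blocks of [sigma]: a row of length d in the r-th factor
    is a block d^r. *)
Lemma big_rows (R : Type) (idx : R) (op : Monoid.com_law idx)
    (F : posint -> nat -> R) :
  \big[op/idx]_(i : tensor_row) F (row_fac i) (row_len i) =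
  \big[op/idx]_(x <- blocks sigma) F x.2 x.1.
Proof.
pose G (x : posint * nat) := F x.1 (nth 0 (val (sigma x.1)) x.2).
transitivity (\big[op/idx]_(i : tensor_row) G (val i)); first by [].
rewrite -(big_map val xpredT G) (perm_big rows); last first.
  apply: uniq_perm; [|exact: rows_uniq|].
    by rewrite map_inj_uniq; [exact: index_enum_uniq|exact: val_inj].
  move=> x; apply/mapP/idP => [[i _ ->]|h]; first exact: (valP i).
  by exists (SeqSub h) => //; rewrite mem_index_enum.
rewrite (perm_big _ (perm_blocks sigma)) !big_allpairs_dep; apply: eq_bigr => r _.
by rewrite [RHS](big_nth 0) /index_iota subn0.
Qed.

Definition row_mon : {cmonom tensor_row} :=
  \big[@mulcm tensor_row/onecm tensor_row]_(i : tensor_row) expcmn (ucm i) (row_len i).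

Lemma row_monE i : row_mon i = row_len i.
Proof.
rewrite /row_mon big_mulcmE.
under eq_bigr do rewrite ucmXE.
rewrite (bigD1 i)//= eqxx mul1n big1 ?addn0// => j.
by move=> /negPf ->.
Qed.

Lemma rows_weight_size : rows_weight row_fac row_mon = type_size sigma.
Proof.
rewrite /rows_weight; under eq_bigr do rewrite row_monE.
rewrite (big_rows addn (fun r d => val r * d)) (perm_big _ (perm_blocks sigma)).
rewrite big_allpairs_dep; apply: eq_bigr => r _.
by rewrite sumnE big_distrr.
Qed.

Lemma rows_series_ser_type g :
  rows_series g row_fac row_mon = ser_type (mulser g) sigma.
Proof.
rewrite ser_type_prod /rows_series; under eq_bigr do rewrite row_monE.
exact: (big_rows _ (fun r d => series_subst (val r) (mulser g d))).
Qed.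

Variable tau : parttype.

Definition label_deg (l : 'I_(size (blocks tau))) : nat :=
  (tnth (in_tuple (blocks tau)) l).1.

Definition label_fac (l : 'I_(size (blocks tau))) : posint :=
  (tnth (in_tuple (blocks tau)) l).2.

Lemma label_deg_gt0 l : 0 < label_deg l.
Proof. exact: blocks_gt0 (mem_tnth l (in_tuple (blocks tau))). Qed.

Definition label_fillings : {set {ffun 'I_(size (blocks tau)) -> tensor_row}} :=
  [set phi | fills row_len label_deg phi & [forall l, row_fac (phi l) == label_fac l]].

Lemma PTosimp_tabloids :
  PTosimp sigma tau = [set tabloid row_of (@cell_col sigma) label_deg phi |
                       phi in label_fillings].
Proof.
apply/finset.setP => T; rewrite inE; apply/idP/imsetP; last first.
  case=> phi; rewrite inE => /andP[pf /forallP fc] ->.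
  have crd := card_tabloid cell_col_lt cell_exists cell_eq pf.
  have trow l c : c \in tabloid row_of (@cell_col sigma) label_deg phi l -> row_of c = phi l.
    exact: tabloid_row.
  apply/and5P; split; last (apply/andP; split).
  - apply/forallP => l; apply/and3P; split.
    + by rewrite -card_gt0 crd label_deg_gt0.
    + apply/forallP => c; apply/implyP => cl; apply/forallP => c'; apply/implyP => c'l.
      by rewrite same_rowE (trow _ _ cl) (trow _ _ c'l).
    apply/forallP => c; apply/implyP => cl; apply/forallP => c'; apply/implyP => c'l.
    apply/forallP => e; apply/implyP => /andP[]; rewrite same_rowE => /eqP ce /andP[h1 h2].
    move: cl c'l; rewrite ffunE !inE -ce => /andP[-> /andP[h3 _]] /andP[_ /andP[_ h4]].
    by rewrite (leq_trans h3 h1) (leq_ltn_trans h2 h4).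
  - apply/forallP => l; apply/forallP => l'; apply/implyP => ll'.
    rewrite disjoint_subset; apply/fintype.subsetP => c cl; rewrite inE.
    by apply: contra ll' => cl'; apply/eqP; apply: tabloid_disjoint cl cl'.
  - apply/forallP => c; have [l cl] := tabloid_cover cell_col_lt pf c.
    by apply/existsP; exists l.
  - by apply/forallP => l; rewrite crd.
  - apply/forallP => l; apply/forallP => c; apply/implyP => cl.
    by rewrite -[cell_factor c]/(row_fac (row_of c)) (trow _ _ cl).
  apply/forallP => l; apply/forallP => l'; apply/implyP => ll'.
  apply/forallP => c; apply/implyP => cl; apply/forallP => c'; apply/implyP => c'l.
  by apply/implyP; rewrite same_rowE => /eqP; apply: tabloid_order cl c'l ll'.
case/and5P => /forallP brick /forallP disj /forallP cov /forallP crd.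
case/andP => /forallP fc /forallP ord.
(* A brick is nonempty and stays in one row, so the row of any of its cells defines [phi]. *)
have ex l : exists i, [exists c in T l, row_of c == i].
  have /and3P[/set0Pn[c cl] _ _] := brick l.
  by exists (row_of c); apply/existsP; exists c; rewrite cl eqxx.
pose phi : {ffun 'I_(size (blocks tau)) -> tensor_row} := [ffun l => xchoose (ex l)].
have Trow l c : c \in T l -> row_of c = phi l.
  move=> cl; rewrite ffunE; have /existsP[c' /andP[c'l /eqP <-]] := xchooseP (ex l).
  apply/eqP; rewrite -same_rowE; have /and3P[_ /forallP/(_ c) + _] := brick l.
  by rewrite cl => /forallP/(_ c'); rewrite c'l.
have Tdisj l l' c : c \in T l -> c \in T l' -> l = l'.
  move=> cl cl'; apply/eqP/negPn/negP => ll'.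
  have /forallP/(_ l') := disj l; rewrite ll' => /pred0P/(_ c) /=.
  by rewrite cl cl'.
have Tcov c : exists l, c \in T l by exact/existsP/cov.
have Tcrd l : #|T l| = label_deg l by apply/eqP/crd.
have Tord (l l' : 'I_(size (blocks tau))) c c' : c \in T l -> c' \in T l' ->
    l < l' -> row_of c = row_of c' -> cell_col c < cell_col c'.
  move=> cl c'l ll' /eqP; rewrite -same_rowE => rr.
  have /forallP/(_ l') := ord l; rewrite ll' => /forallP/(_ c); rewrite cl.
  by move=> /forallP/(_ c'); rewrite c'l rr.
exists phi; last first.
  exact: (@bricks_tabloid _ _ row_of (@cell_col sigma) row_len
    cell_col_lt cell_exists cell_eq _ _ phi T Trow Tdisj Tcov Tcrd Tord).
rewrite inE; apply/andP; split.
  exact: (@bricks_fill _ _ row_of (@cell_col sigma) row_len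
    cell_col_lt cell_exists cell_eq _ _ phi T Trow Tdisj Tcov Tcrd).
apply/forallP => l; have /and3P[/set0Pn[c cl] _ _] := brick l.
by have /forallP/(_ c) := fc l; rewrite cl -(Trow _ _ cl).
Qed.

Lemma card_PTosimp : #|PTosimp sigma tau| = #|label_fillings|.
Proof.
rewrite PTosimp_tabloids card_in_imset// => phi phi'.
rewrite !inE => /andP[pf _] /andP[pf' _].
by apply: (tabloid_inj cell_col_lt cell_exists cell_eq label_deg_gt0).
Qed.

Local Open Scope ring_scope.

(** Expanding the product of the placements gives one monomial for each assignment of labels to rows
    of the right factor, and this monomial is [row_mon] exactly when the bricks fill every row. *)
Lemma fillings_card :
  fillings row_fac row_mon (type_mon tau) = #|PTosimp sigma tau|%:R.
Proof.
rewrite card_PTosimp /fillings /type_mon.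
rewrite -(big_map block_indet xpredT (fun x => ucm x)) cmeval_prod big_map big_tnth.
have plE l : placement row_fac (block_indet (tnth (in_tuple (blocks tau)) l)) =
    \sum_(i | row_fac i == label_fac l) << expcmn (ucm i) (label_deg l) >>.
  by rewrite /placement /= val_posint_of_nat// label_deg_gt0.
under eq_bigr do rewrite plE.
rewrite bigA_distr_big_dep mcoeff_sum.
have malgM : {morph
    (fun m : {cmonom tensor_row} => << m >> : {malg rat[{cmonom tensor_row}]}) :
    m1 m2 / mulcm m1 m2 >-> m1 * m2}.
  by move=> m1 m2; rewrite [RHS]fgmulUU mulr1.
under eq_bigr => phi _.
  rewrite -(big_morph _ malgM (erefl : << onecm tensor_row >> = 1)) mcoeffU1.
  over.
rewrite -natr_sum -sum1_card big_mkcond [in RHS]big_mkcond/=; congr (_%:R).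
apply: eq_bigr => phi _; rewrite [in RHS]inE.
set p := \big[_/_]_(_ <- _) _.
have pE i : p i = (\sum_(l | phi l == i) label_deg l)%N.
  rewrite /p big_mulcmE.
  rewrite [RHS]big_mkcond; apply: eq_bigr => l _; rewrite ucmXE.
  by case: eqP; rewrite ?mul1n.
have -> : (p == row_mon) = fills row_len label_deg phi.
  apply/cmP/forallP => [h i|h i]; first by rewrite -pE h row_monE.
  by rewrite pE (eqP (h i)) row_monE.
rewrite (_ : (phi \in family _) = [forall l, row_fac (phi l) == label_fac l]); last first.
  by apply/familyP/forallP => h l; exact: (h l).
by rewrite andbC; case: [forall _, _]; case: fills.
Qed.

End Rows.

(** * Coefficients in the basis of power sums *)

Section HomogeneousAndElementary.
Local Open Scope ring_scope.
Implicit Types m : {cmonom indet}.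

(** [weightH] and [weightE] are the coefficients of 1/(1 - x) and of 1 - x. *)
Definition weightH (_ : nat) : rat := 1.

Definition weightE (a : nat) : rat := match a with 0 => 1 | 1 => -1 | _ => 0 end.

Lemma weightH_rec (a : nat) : a%:R * weightH a = 1 * \sum_(1 <= e < a.+1) weightH (a - e)%N.
Proof. by rewrite sumr_const_nat subn1 mulr1 mul1r. Qed.

Lemma weightE_rec (a : nat) : a%:R * weightE a = -1 * \sum_(1 <= e < a.+1) weightE (a - e)%N.
Proof.
case: a => [|[|a]].
- by rewrite big_geq// mulr0 mul0r.
- by rewrite big_nat1 subnn mulr1 mul1r.
(* For exponents at least 2 only the last two terms, -1 and 1, are nonzero, and they cancel. *)
rewrite big_nat_recr// big_nat_recr//= subnn subSnn big_nat_cond.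
rewrite big1 => [|e /andP[/andP[_ ea] _]].
  by rewrite add0r addNr !mulr0.
by rewrite !subSn// ltnW.
Qed.

Lemma mulser_weightH d : mulser weightH d = serH d.
Proof.
apply: series_ext => m; rewrite /mulser /serH /gprod big1 ?mulr1//.
Qed.

Lemma mulser_weightE d : mulser weightE d = serE d.
Proof.
apply: series_ext => m; rewrite /mulser /serE /gprod.
case: (mon_deg m == d); rewrite ?andbT ?andbF ?mul0r// mul1r.
case: ifP => [/allP sq|/negbT/allPn[v vm]].
  rewrite (eq_big_seq (fun=> -1)) => [|v vm].
    by rewrite big_const_seq count_predT iter_mulr_1.
  by have := sq v vm; move: vm; rewrite -cmE_neq0; case: (m v) => [|[]].
by rewrite (big_fsetD1 v)//=; case: (m v) => [|[|a]] // _; rewrite mul0r.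
Qed.

End HomogeneousAndElementary.

(** * Existence and uniqueness of the expansion *)

Section CoefficientsInP.
Local Open Scope classical_set_scope.
Local Open Scope ring_scope.

Lemma mon_type_ex (mu : {cmonom indet}) : exists tau, type_mon tau == mu.
Proof. by have [tau <-] := type_mon_surj mu; exists tau. Qed.

Definition mon_type mu : parttype := xchoose (mon_type_ex mu).

Lemma type_monK : cancel type_mon mon_type.
Proof. by move=> tau; apply/type_mon_inj/eqP/(xchooseP (mon_type_ex _)). Qed.

Lemma sum_types n (S : seq {cmonom indet}) (G : {cmonom indet} -> rat) :
  uniq S -> (forall mu, (mu \in S) = (mon_wt mu == n)) ->
  \sum_(rho \in [set: Typ n]) G (type_mon (val rho)) = \sum_(mu <- S) G mu.
Proof.
move=> uS hS; rewrite [RHS]fsbig_seq//.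
apply/esym/(reindex_fsbig (fun rho : Typ n => type_mon (val rho)) setT [set` S] G).
split.
- by move=> rho _ /=; rewrite hS mon_wt_type; apply: (valP rho).
- by move=> rho rho' _ _ /type_mon_inj/val_inj.
move=> mu; rewrite /= hS => /eqP wmu; have [tau tE] := type_mon_surj mu.
have tn : type_size tau == n by rewrite -mon_wt_type tE wmu.
by exists (exist _ tau tn : Typ n).
Qed.

Variables (g : nat -> rat) (eps : rat).
Hypothesis g0 : g 0%N = 1.
Hypothesis g_rec : forall a : nat, a%:R * g a = eps * \sum_(1 <= e < a.+1) g (a - e)%N.

Lemma coefP_mulser n (sigma tau : Typ n) :
  coefP (ser_type (mulser g) (val sigma)) tau
    (eps ^+ type_length (val tau) * #|PTosimp (val sigma) (val tau)|%:R
       / (z_type (val tau))%:R).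
Proof.
have [S0 [uS0 hS0]] := types_of_wt n; pose S := [seq mu <- S0 | mon_wt mu == n].
have uS : uniq S by rewrite filter_uniq.
have hS mu : (mu \in S) = (mon_wt mu == n).
  by rewrite mem_filter; case: eqP => // /hS0.
pose c (rho : Typ n) : rat := eps ^+ type_length (val rho) *
  #|PTosimp (val sigma) (val rho)|%:R / (z_type (val rho))%:R.
pose cm := fill_coef eps (@row_fac (val sigma)) (row_mon (val sigma)).
have cE rho : c rho = cm (type_mon (val rho)).
  by rewrite /cm /fill_coef mdeg_type_mon fillings_card z_mon_type.
have expE (b : {cmonom indet} -> rat) m :
    \sum_(rho \in [set: Typ n]) b (type_mon (val rho)) * ser_type serP (val rho) m =
    \sum_(mu <- S) b mu * cmeval blockser mu m.
  rewrite -(sum_types (fun mu => b mu * cmeval blockser mu m) uS hS).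
  by apply: eq_fsbigr => rho _; rewrite cmeval_type_mon.
have cexp m : ser_type (mulser g) (val sigma) m =
    \sum_(mu <- S) cm mu * cmeval blockser mu m.
  rewrite -rows_series_ser_type; apply: rows_series_expansion => // mu.
  by rewrite rows_weight_size (eqP (valP sigma)) hS => ->.
exists c; split=> // [m|c' c'exp].
  rewrite cexp -expE; apply: eq_fsbigr => rho _; congr (_ * _).
  exact: esym (cE rho).
(* Transports [c'] to monomials; [sigma] is only the default for monomials of a weight other than
   n. *)
pose cm' mu := c' (insubd sigma (mon_type mu)).
have cE' rho : c' rho = cm' (type_mon (val rho)).
  by rewrite /cm' type_monK valKd.
(* The difference of two expansions of the same series is a vanishing combination of the P_mu. *)
have eqcm : {in S, forall mu, cm' mu - cm mu = 0}.
  apply: cmeval_blockser_free => // m.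
  under eq_bigr do rewrite mulrBl.
  rewrite big_split /= sumrN -cexp -expE (c'exp m).
  by under eq_fsbigr do rewrite -cE'; rewrite subrr.
move=> rho; apply/eqP; rewrite -subr_eq0 cE cE' eqcm// hS mon_wt_type.
exact: (valP rho).
Qed.

End CoefficientsInP.

Local Open Scope ring_scope.

Theorem theorem39 (n : nat) (sigma tau : Typ n) :
  coefP (ser_type serH (val sigma)) tau
    (#|PTosimp (val sigma) (val tau)|%:R / (z_type (val tau))%:R) /\
  coefP (ser_type serE (val sigma)) tau
    ((-1) ^+ type_length (val tau) * #|PTosimp (val sigma) (val tau)|%:R
       / (z_type (val tau))%:R).
Proof.
have <- : mulser weightH = serH by apply/funext => d; exact: mulser_weightH.
have <- : mulser weightE = serE by apply/funext => d; exact: mulser_weightE.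
split; last exact: coefP_mulser weightE_rec _ _ _.
by have := coefP_mulser (erefl : weightH 0%N = 1) weightH_rec sigma tau; rewrite expr1n mul1r.
Qed.
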